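(* Let $A$ be an expanding $d\times d$ integer matrix with $|\det A|=q$, let $\mathcal{D}=\{d_1,\dots,d_N\}\subset\mathbb{Z}^d$, let $S_i(x)=A^{-1}(x+d_i)$ for $1\le i\le N$, and let $K$ be the unique nonempty compact set with $K=\bigcup_{i=1}^N S_i(K)$. Let $J\subset\mathbb{R}^d$ be a nonempty bounded closed set with $S_i(J)\subset J$ for all $i$, and let $(X,\mathcal{E})$, $\mathcal{E}=\mathcal{E}_v\cup\mathcal{E}_h$, be the graph induced by the iterated function system $\{S_i\}_{i=1}^N$ and $J$. Let $w$ be a pseudo-norm associated with $A$. Then the graph $(X,\mathcal{E})$ is hyperbolic. Moreover, $K$ is Hölder equivalent to the hyperbolic boundary $\partial X$ of $(X,\mathcal{E})$: there exist a bijective map $\phi:\partial X\to K$ and a constant $C>0$ such that $$C^{-1}w(\phi(\xi)-\phi(\eta))\le\rho_a(\xi,\eta)^{\alpha}\le C\,w(\phi(\xi)-\phi(\eta)),\quad\forall\ \xi\neq\eta\in\partial X,$$ where $\alpha=\frac{\log q}{da}$ and $\rho_a$ is the visual metric with parameter $a$.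
   Context: A matrix is expanding if all its eigenvalues have modulus strictly greater than $1$. Graph: let $\Sigma=\{1,\dots,N\}$ and $\Sigma^*=\bigcup_{n\ge0}\Sigma^n$, where $\Sigma^0$ consists of the empty word only. For $\mathbf{u}=i_1\cdots i_n\in\Sigma^n$ put $|\mathbf{u}|=n$ and $S_{\mathbf{u}}=S_{i_1}\circ\cdots\circ S_{i_n}$. Declare $\mathbf{u}\sim\mathbf{v}$ if $S_{\mathbf{u}}=S_{\mathbf{v}}$; let $X_n=\Sigma^n/\!\sim$ and $X=\bigcup_{n\ge0}X_n$, and write $\mathbf{u}$ also for its class. Vertical edges: $(\mathbf{u},\mathbf{v})\in\mathcal{E}_v$ iff there are $\mathbf{i}\in[\mathbf{u}]$, $\mathbf{j}\in[\mathbf{v}]$ and $\ell\in\Sigma$ with $\mathbf{j}=\mathbf{i}\ell$ or $\mathbf{i}=\mathbf{j}\ell$. Horizontal edges: $$\mathcal{E}_h=\bigcup_{n\ge1}\{(\mathbf{u},\mathbf{v})\in X_n\times X_n:\ \mathbf{u}\ne\mathbf{v},\ S_{\mathbf{u}}(J)\cap S_{\mathbf{v}}(J)\ne\emptyset\}.$$ Hyperbolicity: let $o$ be the root (empty word), $d(\cdot,\cdot)$ the graph distance, $|x|=d(o,x)$, and $|x\wedge y|=\frac12(|x|+|y|-d(x,y))$ the Gromov product. The graph is hyperbolic if there is $\delta\ge0$ with $|x\wedge y|\ge\min\{|x\wedge z|,|z\wedge y|\}-\delta$ for all $x,y,z\in X$. For $a>0$ with $\exp(3\delta a)<\sqrt2$,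 set $\rho_a(x,y)=\delta_{x,y}\exp(-a|x\wedge y|)$, where $\delta_{x,y}=0$ if $x=y$ and $1$ if $x\neq y$; $\rho_a$ is equivalent to a metric on $X$ and is called the visual metric. Let $\hat X$ be the $\rho_a$-completion of $X$ and $\partial X=\hat X\setminus X$ the hyperbolic boundary; its points are represented by geodesic rays. $\rho_a$ is extended to $\partial X$ by $\rho_a(\xi,\eta)=\exp(-a|\xi\wedge\eta|)$ for $\xi\ne\eta$, with the standard extension of the Gromov product to the boundary (different standard choices change $\rho_a$ only by bounded multiplicative constants). Pseudo-norm: write $B_r$ for the open ball in $\mathbb{R}^d$ with center $0$ and radius $r$. Fix $0<\epsilon_0<1/2$ and a $C^\infty$ function $\varphi\ge 0$ supported in $B_{\epsilon_0}$ with $\varphi(x)=\varphi(-x)$ and $\int_{\mathbb{R}^d}\varphi=1$. Let $V=AB_1\setminus B_1$, $h=\chi_V*\varphi$ (convolution), and $w(x)=\sum_{n=-\infty}^{\infty}q^{-n/d}h(A^nx)$ for $x\in\mathbb{R}^d$. Then: (1) $w(x)=w(-x)$, and $w(x)=0$ iff $x=0$; (2) $w(Ax)=q^{1/d}w(x)$; (3) there is $\beta>0$ with $w(x+y)\le\beta\max\{w(x),w(y)\}$ for all $x,y$.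
   Formalization: The property w(x)=0 iff x=0 is required of the pseudo-norm w as a hypothesis, because it does not follow from the stated conditions on φ when φ vanishes near 0, and the inequality can then fail. *)

(* Defs.v *)
From HB Require Import structures.
From mathcomp Require Import all_boot all_order all_algebra.
From mathcomp Require Import all_classical all_reals all_analysis.
From mathcomp Require Import complex generic_quotient.

Set Implicit Arguments.
Unset Strict Implicit.
Unset Printing Implicit Defensive.

Import Order.TTheory GRing.Theory Num.Theory.
Import numFieldNormedType.Exports.

Local Open Scope classical_set_scope.
Local Open Scope ring_scope.
Local Open Scope quotient_scope.

Section Graph.
Variables (R : realType) (T : eqType) (e : rel T) (o : T).

Definition walk (x y : T) (n : nat) : Prop :=
  exists p : seq T, [/\ path e x p, last x p = y & size p = n].

(* The value 0 for unconnected vertices is never used: the graphs below are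
   connected. *)
Definition graph_dist (x y : T) : nat :=
  if pselect (exists n, `[< walk x y n >]) is left h then ex_minn h else 0%N.

Definition gromov_product (x y : T) : R :=
  ((graph_dist o x)%:R + (graph_dist o y)%:R - (graph_dist x y)%:R) / 2.

Definition hyperbolic_with (delta : R) : Prop :=
  0 <= delta /\
  forall x y z : T,
    Num.min (gromov_product x z) (gromov_product z y) - delta
      <= gromov_product x y.

Definition hyperbolic : Prop := exists delta : R, hyperbolic_with delta.

Definition visual_metric (a : R) (x y : T) : R :=
  (x != y)%:R * expR (- a * gromov_product x y).

Definition visual_cauchy (a : R) (s : nat -> T) : Prop :=
  forall eps : R, 0 < eps -> exists M : nat, forall m n : nat,
    (M <= m)%N -> (M <= n)%N -> visual_metric a (s m) (s n) < eps.

(* A point of the completion is a set of Cauchy sequences, namely a class for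
   the relation "the mutual visual distance tends to 0". *)
Definition cauchy_class (a : R) (s : nat -> T) : set (nat -> T) :=
  [set t | visual_cauchy a t /\
           (fun n => visual_metric a (s n) (t n)) @ \oo --> (0 : R)].

Definition completion (a : R) : set (set (nat -> T)) :=
  [set cauchy_class a s | s in visual_cauchy a].

Definition completion_embed (a : R) (x : T) : set (nat -> T) :=
  cauchy_class a (fun=> x).

Definition hyperbolic_boundary (a : R) : set (set (nat -> T)) :=
  completion a `\` range (completion_embed a).

(* liminf of (s_m | t_n) as m and n tend to infinity independently *)
Definition gromov_liminf (s t : nat -> T) : \bar R :=
  ereal_sup (range (fun M : nat =>
    ereal_inf [set (gromov_product (s k.1) (t k.2))%:E
              | k in [set k : nat * nat | (M <= k.1)%N /\ (M <= k.2)%N]])).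

(* The supremum of the liminf over all representing sequences, which is the
   usual convention for the extended Gromov product; it is finite for distinct
   boundary points. *)
Definition gromov_product_boundary (xi eta : set (nat -> T)) : \bar R :=
  ereal_sup [set gromov_liminf st.1 st.2
            | st in [set st : (nat -> T) * (nat -> T) | xi st.1 /\ eta st.2]].

Definition visual_metric_boundary (a : R) (xi eta : set (nat -> T)) : R :=
  (~~ `[< xi = eta >])%:R * expR (- a * fine (gromov_product_boundary xi eta)).

End Graph.

Definition real_mx (R : realType) (m n : nat) (M : 'M[int]_(m, n)) :
  'M[R]_(m, n) := map_mx intr M.

(* For the eigenvalues, the matrix is viewed over the complex numbers. *)
Definition expanding (R : realType) (d : nat) (A : 'M[int]_d) : Prop :=
  forall lam : R[i],
    eigenvalue (map_mx intr A : 'M[R[i]]_d) lam -> 1 < `|lam|.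

Section IFS.
Variables (R : realType) (d N : nat).
Variables (A : 'M[int]_d) (D : 'I_N -> 'cV[int]_d).

Definition ifs_map (i : 'I_N) (x : 'cV[R]_d) : 'cV[R]_d :=
  invmx (real_mx R A) *m (x + real_mx R (D i)).

Definition word_map (u : seq 'I_N) : 'cV[R]_d -> 'cV[R]_d :=
  foldr (fun i f => ifs_map i \o f) id u.

(* Only words of equal length are identified, so that the quotient of all
   words is the disjoint union of the quotients of the sets of words of length
   n. *)
Definition word_equiv : rel (seq 'I_N) :=
  fun u v => (size u == size v) && `[< word_map u = word_map v >].

Lemma word_equiv_refl : reflexive word_equiv.
Proof. by move=> u; rewrite /word_equiv eqxx; apply/asboolP. Qed.

Lemma word_equiv_sym : symmetric word_equiv.
Proof.
move=> u v; rewrite /word_equiv eq_sym; congr andb.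
by apply/asboolP/asboolP => ->.
Qed.

Lemma word_equiv_trans : transitive word_equiv.
Proof.
move=> v u w /andP[/eqP suv /asboolP uv] /andP[/eqP svw /asboolP vw].
by rewrite /word_equiv suv svw eqxx; apply/asboolP; rewrite uv.
Qed.

Canonical word_equivRel :=
  EquivRel word_equiv word_equiv_refl word_equiv_sym word_equiv_trans.

Definition vertex := {eq_quot word_equivRel}.
HB.instance Definition _ := Choice.on vertex.

Definition word_class (u : seq 'I_N) : vertex := \pi_vertex u.

Definition root_vertex : vertex := word_class [::].

Definition vertical_edge (x y : vertex) : Prop :=
  exists (u v : seq 'I_N) (l : 'I_N),
    [/\ word_class u = x, word_class v = y & v = rcons u l \/ u = rcons v l].

Definition horizontal_edge (J : set 'cV[R]_d) (x y : vertex) : Prop :=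
  exists u v : seq 'I_N,
    [/\ (0 < size u)%N /\ size u = size v,
        word_class u = x, word_class v = y, x <> y &
        (word_map u @` J) `&` (word_map v @` J) !=set0].

Definition ifs_graph (J : set 'cV[R]_d) : rel vertex :=
  fun x y => `[< vertical_edge x y \/ horizontal_edge J x y >].

End IFS.

Arguments vertical_edge {R d N} A D x y.
Arguments horizontal_edge {R d N} A D J x y.
Arguments ifs_graph {R d N} A D J x y.

Section PseudoNorm.
Variable R : realType.

(* The topology of the library on vectors comes from the maximum norm; the
   balls used for pseudo-norms are Euclidean. *)
Definition euclidean_norm (d : nat) (x : 'cV[R]_d) : R :=
  Num.sqrt (\sum_(i < d) x i 0 ^+ 2).

Definition euclidean_ball (d : nat) (r : R) : set 'cV[R]_d :=
  [set x | euclidean_norm x < r].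

Fixpoint Ck_fun (k : nat) (d : nat) (f : 'cV[R]_d -> R) : Prop :=
  continuous f /\
  if k is k'.+1 then
    forall i : 'I_d,
      (forall x : 'cV[R]_d, derivable f x (delta_mx i 0 : 'cV[R]_d)) /\
      Ck_fun k' (fun x => 'D_(delta_mx i 0 : 'cV[R]_d) f x)
  else True.

Definition smooth (d : nat) (f : 'cV[R]_d -> R) : Prop :=
  forall k : nat, Ck_fun k f.

(* The Lebesgue integral over R^d, as an iterated integral; by Tonelli's
   theorem it agrees with the integral for the d-dimensional Lebesgue measure
   on nonnegative Borel functions, the only ones integrated below. *)
Fixpoint integral_cV (d : nat) : ('cV[R]_d -> \bar R) -> \bar R :=
  match d with
  | 0 => fun f => f 0
  | d'.+1 => fun f =>
      (\int[lebesgue_measure]_(t in [set: R])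
         integral_cV (fun y : 'cV[R]_d' =>
           f (col_mx (const_mx t : 'cV[R]_1) y : 'cV[R]_(1 + d'))))%E
  end.

Variable d : nat.
Variables (A : 'M[int]_d.+1) (q : nat).

Definition shell : set 'cV[R]_d.+1 :=
  [set real_mx R A *m x | x in euclidean_ball 1]
    `\` euclidean_ball 1.

Definition shell_convolution (phi : 'cV[R]_d.+1 -> R) (x : 'cV[R]_d.+1) : R :=
  fine (integral_cV (fun y => (\1_shell y * phi (x - y))%:E)).

(* All the terms are nonnegative and finitely many are nonzero. *)
Definition pseudo_norm_of (phi : 'cV[R]_d.+1 -> R) (x : 'cV[R]_d.+1) : R :=
  fine (\esum_(n in [set: int])
    (q%:R `^ (- n%:~R / d.+1%:R)
       * shell_convolution phi (real_mx R A ^ n *m x))%:E)%E.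

(* The definiteness of w is listed because it does not follow from the other
   conditions when phi vanishes near 0; it does as soon as phi 0 > 0. *)
Definition pseudo_norm (w : 'cV[R]_d.+1 -> R) : Prop :=
  (exists (eps0 : R) (phi : 'cV[R]_d.+1 -> R),
    [/\ 0 < eps0 < 1 / 2,
        smooth phi,
        (forall x, 0 <= phi x) /\ (forall x, phi (- x) = phi x),
        (forall x, phi x != 0 -> euclidean_ball eps0 x) /\
        integral_cV (fun x => (phi x)%:E) = 1%E &
        forall x, w x = pseudo_norm_of phi x]) /\
  (forall x, w x = 0 <-> x = 0).

End PseudoNorm.

(* Main.v *)
Require Import Defs.
From HB Require Import structures.
From mathcomp Require Import all_boot all_order all_algebra.
From mathcomp Require Import all_classical all_reals all_analysis.
From mathcomp Require Import complex generic_quotient ring lra zify.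

Import Order.TTheory GRing.Theory Num.Theory.
Import numFieldNormedType.Exports.

Local Open Scope classical_set_scope.
Local Open Scope ring_scope.

(** Write [B] for the real matrix of [A], so that the word map of [u] is
[x |-> B ^- |u| *m (x + d_u)] with an integral vector [d_u], and fix a point
[p] of [K]; the center of a vertex is the image of [p] under its word map.  The
theorem rests on one fact: up to a bounded error, the Gromov product of two
vertices [x] and [y] is the largest [k], at most the levels of [x] and [y], for
which [B ^+ k *m (center x - center y)] is bounded.

- Upper bound ([walk_center]).  An edge at level [n] moves the center by at most
  a constant times the size of [B ^- n].  A walk of length [l] from [x] to [y]
  has its [i]-th vertex at level at least [|x| - i] and at least
  [|y| - (l - i)]; seen from the level [k = (|x| + |y| - l) / 2] its steps thus
  form two geometric series, and their sum is bounded.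

- Lower bound ([close_centers_dist]).  If the dilated centers are close at level
  [k], let [u] and [v] be the ancestors of [x] and [y] at level [k - M].  Then
  [d_u - d_v] lies within [O(rho ^+ M)] of the compact set [J - J].  Integral
  vectors are discrete, so for [M] large, independently of [x] and [y], it lies
  in [J - J], which means that [u] and [v] coincide or are joined by a
  horizontal edge; this gives a walk of length at most
  [|x| + |y| - 2 * k + 2 * M + 1].

Closeness at level [k] is transitive up to doubling the bound, hence the graph
is hyperbolic ([hyperbolic_of_centers]).  For the visual metric, a Cauchy
sequence of vertices is either eventually constant or leaves every level, and
then its centers converge to a point of [K]; two such sequences are equivalent
exactly when the limits agree.  So the boundary points are the sets of
sequences converging to a given point of [K] ([hyperbolic_boundaryE]), which is
the bijection, and the Gromov product of the boundary points of [x] and [y] is,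
up to a bounded error, the integer [k] for which [B ^ k *m (x - y)] has unit
size ([gromov_product_boundary_scale]).

The pseudo-norm measures the same [k]: [w v] is comparable to [q ^ (- k / d)]
when [B ^ k *m v] has unit size ([pseudo_norm_scale]).  The summand of index [n]
vanishes unless [n] is close to [k], and the summands are bounded; conversely
one summand is bounded below, by definiteness of [w], lower semicontinuity of
the convolution and compactness of an annulus.  With [alpha = ln q / (d * a)]
the power [alpha] of the visual distance is [q ^ (- g / d)], where [g] is the
Gromov product, and the two estimates combine.

The growth of the powers of [B] that is used throughout comes from the
Cayley-Hamilton theorem ([expanding_contraction]). *)

Set Implicit Arguments.
Unset Strict Implicit.
Unset Printing Implicit Defensive.

(** * Matrices and the maximum norm *)

Section MatrixNorm.
Variable R : realType.

Lemma norm_entry_le m n (M : 'M[R]_(m, n)) i j : `|M i j| <= `|M|.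
Proof.
rewrite [leRHS]/Num.Def.normr /= mx_normrE.
exact: (le_bigmax _ (fun ij : 'I_m * 'I_n => `|M ij.1 ij.2|) (i, j)).
Qed.

Lemma norm_le_entries m n (M : 'M[R]_(m, n)) c :
  0 <= c -> (forall i j, `|M i j| <= c) -> `|M| <= c.
Proof.
move=> c0 Mc; rewrite /Num.Def.normr /= mx_normrE.
by apply: bigmax_le => // -[i j] _ /=.
Qed.

Lemma norm_mulmx_le m n p (M : 'M[R]_(m, n)) (x : 'M[R]_(n, p)) :
  `|M *m x| <= n%:R * `|M| * `|x|.
Proof.
apply: norm_le_entries => [|i j]; first by rewrite !mulr_ge0.
rewrite mxE (le_trans (ler_norm_sum _ _ _)) //.
rewrite -mulrA -[n in n%:R]card_ord mulr_natl -sumr_const.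
by apply: ler_sum => k _; rewrite normrM ler_pM ?norm_entry_le.
Qed.

Lemma lipschitz_cts (V W : normedModType R) (f : V -> W) (c : R) :
  0 <= c -> (forall x y, `|f x - f y| <= c * `|x - y|) -> continuous f.
Proof.
move=> c0 fc x; apply/cvgrPdist_le => e e0.
apply/nbhs_normP; exists (e / (c + 1)); first by rewrite /= divr_gt0 // ltr_wpDl.
move=> y /= /ltW xy; rewrite (le_trans (fc _ _)) //.
apply: (@le_trans _ _ ((c + 1) * `|x - y|)); first by rewrite ler_wpM2r // lerDl.
by rewrite -ler_pdivlMl ?ltr_wpDl // mulrC.
Qed.

Lemma mulmx_continuous m n p (M : 'M[R]_(m, n)) :
  continuous (fun x : 'M[R]_(n, p) => M *m x).
Proof.
apply: (@lipschitz_cts _ _ _ (n%:R * `|M|)) => [|x y]; first by rewrite mulr_ge0.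
by rewrite -mulmxBr norm_mulmx_le.
Qed.

(** Transposition turns this into the corresponding fact for row vectors. *)
Lemma cV_compact n (S : set 'cV[R]_n) : bounded_set S -> closed S -> compact S.
Proof.
move=> [M [Mr bS]] cS.
have tc p r : continuous (fun x : 'M[R]_(p, r) => x^T).
  apply: (@lipschitz_cts _ _ _ 1) => // x y; rewrite mul1r.
  rewrite -raddfB; apply: norm_le_entries => [|i j]; first exact: normr_ge0.
  by rewrite mxE norm_entry_le.
have -> : S = (fun x : 'rV[R]_n => x^T) @` ((fun x : 'rV[R]_n => x^T) @^-1` S).
  apply/seteqP; split => [x Sx|x [y /= Sy <-]//].
  by exists x^T; rewrite /= trmxK.
apply: continuous_compact; first exact/continuous_subspaceT/tc.
apply: bounded_closed_compact; last first.
  by apply: preimage_closed => // x _; exact: tc.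
exists M; split=> // y My x /= /(bS _ My); apply: le_trans.
apply: norm_le_entries => // i j.
by have := norm_entry_le x^T j i; rewrite mxE.
Qed.

End MatrixNorm.

(** * Growth of the powers of an expanding matrix *)

Section Contraction.
Local Open Scope complex_scope.
Variable R : realType.

Lemma normc_real (z : R[i]) : {r : R | 0 <= r & `|z| = r%:C}.
Proof.
exists (Num.sqrt (complex.Re z ^+ 2 + complex.Im z ^+ 2)); first exact: sqrtr_ge0.
by rewrite normc_def.
Qed.

(** A ratio strictly between the moduli and 1 is what lets each step of
[recurrent_powers_bounded] absorb the previous one without a loss. *)
Lemma common_contraction_ratio (s : seq R[i]) :
  (forall z, z \in s -> `|z| < 1) ->
  exists2 rho : R, 0 < rho < 1 & forall z, z \in s -> `|z| < rho%:C.
Proof.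
elim: s => [_|z s IH zs1]; first by exists (2^-1) => //; apply/andP; split; lra.
have [|rho /andP[rho0 rho1] srho] := IH.
  by move=> y ys; rewrite zs1 // in_cons ys orbT.
have [r r0 zr] := normc_real z.
have r1 : r < 1 by have := zs1 z (mem_head _ _); rewrite zr -(rmorph1 (real_complex R)) ltcR.
pose t := Num.max rho ((r + 1) / 2).
exists t; first by rewrite /t lt_max rho0 gt_max rho1 /=; lra.
move=> y; rewrite in_cons => /orP[/eqP->|/srho ys].
  by rewrite zr ltcR lt_max; apply/orP; right; lra.
by rewrite (lt_le_trans ys) // lecR le_max lexx.
Qed.

(** Each factor [G - z%:M] contributes a first-order recurrence
[u (k + 1) = z *: u k + v k], in which [v] is bounded by a multiple of
[rho ^+ k] by induction on [s]; as the modulus of [z] is less than [rho], so is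
[u]. *)
Lemma recurrent_powers_bounded n (G M : 'M[R[i]]_n.+1) (rho : R) (s : seq R[i]) :
  0 < rho -> (forall z, z \in s -> `|z| < rho%:C) ->
  (\prod_(z <- s) (G - z%:M)) * M = 0 ->
  exists2 c : R[i], 0 <= c &
    forall k i j, `|(G ^+ k * M) i j| <= c * rho%:C ^+ k.
Proof.
move=> rho0; elim: s M => [|z s IH] M zs.
  rewrite big_nil mul1r => ->; exists 0 => // k i j.
  by rewrite mulr0 mxE normr0 mul0r.
have zrho : `|z| < rho%:C by apply: zs; rewrite mem_head.
have cS (X : 'M[R[i]]_n.+1) y : GRing.comm X y%:M.
  by rewrite /GRing.comm -!mulmxE mul_mx_scalar mul_scalar_mx.
have commG : GRing.comm (G - z%:M) (\prod_(y <- s) (G - y%:M)).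
  apply: commr_prod => y _; apply: commrB => //.
  by apply/commr_sym/commrB.
rewrite big_cons commG -mulrA => /IH[|c c0 Hc].
  by move=> y ys; apply: zs; rewrite in_cons ys orbT.
(* large enough for the first term, and for the inhomogeneous part [v] *)
pose c' := \sum_i \sum_j `|M i j| + c / (rho%:C - `|z|).
have d0 : 0 < rho%:C - `|z| by rewrite subr_gt0.
have c'0 : 0 <= c'.
  by rewrite addr_ge0 ?divr_ge0 // ?(ltW d0) // sumr_ge0 // => i _; rewrite sumr_ge0.
exists c' => // k i j; elim: k i j => [|k IHk] i j.
  rewrite expr0 mul1r mulr1 /c'.
  rewrite (bigD1 i) //= (bigD1 j) //= -!addrA lerDl addr_ge0 //.
    by rewrite sumr_ge0.
  rewrite addr_ge0 ?divr_ge0 // ?(ltW d0) // sumr_ge0 // => a _.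
  by rewrite sumr_ge0.
have -> : G ^+ k.+1 * M = z *: (G ^+ k * M) + G ^+ k * ((G - z%:M) * M).
  have -> : z *: (G ^+ k * M) = G ^+ k * (z%:M * M).
    by rewrite -!mulmxE mul_scalar_mx scalemxAr.
  by rewrite -mulrDr mulrBl addrC subrK exprSr mulrA.
rewrite !mxE (le_trans (ler_normD _ _)) // normrM.
have := Hc k i j; rewrite mxE => /(lerD (ler_wpM2l (normr_ge0 z) (IHk i j))).
rewrite mxE; move/le_trans; apply.
have {1}-> : c = (c / (rho%:C - `|z|)) * (rho%:C - `|z|).
  by rewrite divfK // gt_eqF.
have r0 : 0 <= rho%:C ^+ k :> R[i] by rewrite exprn_ge0 // lecR ltW.
rewrite exprS [`|z| * _]mulrA -mulrDl [c' * (_ * _)]mulrA ler_wpM2r //.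
rewrite [`|z| * _]mulrC.
apply: (@le_trans _ _ (c' * `|z| + c' * (rho%:C - `|z|))).
  rewrite lerD2l ler_wpM2r ?(ltW d0) // /c' lerDr sumr_ge0 // => a _.
  by rewrite sumr_ge0.
by rewrite -mulrDr addrC subrK.
Qed.

Lemma expanding_unitmx d (A : 'M[int]_d.+1) :
  expanding R A -> real_mx R A \in unitmx.
Proof.
move=> expA; rewrite unitmxE unitfE det_map_mx intr_eq0; apply/negP => /eqP detA.
have /expA : eigenvalue (map_mx intr A : 'M[R[i]]_d.+1) 0.
  rewrite eigenvalue_root_char /root horner_coef0 char_poly_det det_map_mx detA.
  by rewrite mulr0.
by rewrite normr0 ltr10.
Qed.

(** By Cayley-Hamilton the product of the [G - z%:M] over the eigenvalues [z]
vanishes; dividing by powers of [G], the inverse of [G] is annihilated by the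
product over the [z^-1], all of modulus less than 1. *)
Lemma expanding_contraction d (A : 'M[int]_d.+1) :
  expanding R A ->
  exists C rho : R, [/\ 0 < C, 0 < rho < 1 &
    forall n (x : 'cV[R]_d.+1),
      `|invmx (real_mx R A) ^+ n *m x| <= C * rho ^+ n * `|x|].
Proof.
move=> expA; have uB := expanding_unitmx expA.
pose G : 'M[R[i]]_d.+1 := map_mx intr A.
have GE : G = map_mx (real_complex R) (real_mx R A).
  by apply/matrixP => i j; rewrite !mxE rmorph_int.
have uG : G \in unitmx by rewrite GE map_unitmx.
have [s Es] := closed_field_poly_normal (char_poly G).
move: Es; rewrite (monicP (char_poly_monic G)) scale1r => Es.
have s1 z : z \in s -> 1 < `|z|.
  move=> zs; apply: expA.
  by rewrite eigenvalue_root_char -/G Es root_prod_XsubC.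
have HG : \prod_(z <- s) (G - z%:M) = 0.
  rewrite -(Cayley_Hamilton G) Es rmorph_prod /=.
  by apply: eq_bigr => z _; rewrite rmorphB /= horner_mx_X horner_mx_C.
pose H : 'M[R[i]]_d.+1 := invmx G.
have HI : \prod_(z <- [seq z^-1 | z <- s]) (H - z%:M) * 1 = 0.
  rewrite mulr1 big_map.
  have -> : \prod_(z <- s) (H - z^-1%:M) =
      (\prod_(z <- s) (- z^-1)) *: (H ^+ size s * \prod_(z <- s) (G - z%:M)).
    have : forall z, z \in s -> z != 0.
      by move=> z /s1; apply: contraTneq => ->; rewrite normr0 ltr10.
    elim: (s) => [_|z r IH zr]; first by rewrite !big_nil expr0 mul1r scale1r.
    rewrite !big_cons IH; last by move=> y yr; rewrite zr // in_cons yr orbT.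
    have cGH : GRing.comm (H ^+ size r) (G - z%:M).
      apply: commr_sym; apply: commrX; rewrite /GRing.comm mulrBl mulrBr.
      rewrite -!mulmxE mulVmx // mulmxV // mul_mx_scalar mul_scalar_mx //.
    have -> : H - z^-1%:M = (- z^-1) *: (H * (G - z%:M)).
      rewrite mulrBr -!mulmxE mulVmx // mul_mx_scalar scaleNr scalerBr scalerA.
      rewrite mulVf ?scale1r; last by rewrite zr ?mem_head.
      by rewrite opprB scalemx1.
    rewrite -scalerAl -scalerAr scalerA /= exprS; congr (_ *: _).
    by rewrite -!mulrA; congr (_ * _); rewrite !mulrA cGH.
  by rewrite HG mulr0 scaler0.
have [|rho /andP[rho0 rho1] srho] := common_contraction_ratio (s := [seq z^-1 | z <- s]).
  move=> z /mapP[y /s1 y1 ->]; rewrite normfV invf_lt1 //.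
  exact: lt_trans y1.
have [c c0 Hc] := recurrent_powers_bounded rho0 srho HI.
have [c' c'0 cE] := normc_real c.
move: cE; rewrite ger0_norm // => cE.
exists (d.+1%:R * c' + 1), rho; split => //.
- by rewrite ltr_wpDl // mulr_ge0.
- by rewrite rho0.
move=> n x.
have hn : `|invmx (real_mx R A) ^+ n| <= c' * rho ^+ n.
  apply: norm_le_entries => [|i j]; first by rewrite mulr_ge0 // exprn_ge0 // ltW.
  have := Hc n i j; rewrite mulr1 /H GE -map_invmx -rmorphXn /= mxE cE.
  rewrite -rmorphXn -rmorphM /=.
  have [r r0 nr] := normc_real ((invmx (real_mx R A) ^+ n) i j)%:C.
  rewrite -lecR; apply: le_trans.
  rewrite normc_def /= expr0n /= addr0 sqrtr_sqr //.
rewrite (le_trans (norm_mulmx_le _ _)) // -!mulrA mulrDl.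
rewrite -[leLHS]addr0 lerD ?mulr_ge0 ?exprn_ge0 ?(ltW rho0) //.
by rewrite -mulrA ler_wpM2l // mulrA ler_wpM2r.
Qed.

End Contraction.

Lemma real_mxB (R : realType) m n (M P : 'M[int]_(m, n)) :
  real_mx R (M - P) = real_mx R M - real_mx R P.
Proof. by apply/matrixP => i j; rewrite !mxE rmorphB. Qed.

Section Expansion.
Variable R : realType.

(** Contraction of the powers of [invmx B], phrased with the powers of [B] so that
no inverse appears in the estimates below. *)
Definition expands_with d (B : 'M[R]_d.+1) (C rho : R) : Prop :=
  [/\ B \in unitmx, 0 < C, 0 < rho < 1 &
    forall n (x : 'cV[R]_d.+1), `|x| <= C * rho ^+ n * `|B ^+ n *m x|].

Lemma expanding_expands_with d (A : 'M[int]_d.+1) :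
  expanding R A -> exists C rho : R, expands_with (real_mx R A) C rho.
Proof.
move=> expA; have uB := expanding_unitmx expA.
have [C [rho [C0 rho01 Cx]]] := expanding_contraction expA.
exists C, rho; split=> // n x; have := Cx n (real_mx R A ^+ n *m x).
by rewrite mulmxA mulmxE [invmx _]/(_^-1) exprVn mulVr ?unitrX // mul1mx.
Qed.

Lemma expands_with_le d (B : 'M[R]_d.+1) C rho k n (x : 'cV[R]_d.+1) :
  expands_with B C rho -> (k <= n)%N ->
  `|B ^+ k *m x| <= C * rho ^+ (n - k) * `|B ^+ n *m x|.
Proof.
move=> [_ _ _ Bx] kn; rewrite (le_trans (Bx (n - k)%N _)) //.
by rewrite mulmxA mulmxE -exprD subnK.
Qed.

Lemma geometric_small (rho c e : R) :
  0 < rho < 1 -> 0 < e -> exists M, forall n, (M <= n)%N -> c * rho ^+ n < e.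
Proof.
move=> /andP[r0 r1] e0.
have : (fun n => `|c| * rho ^+ n) @ \oo --> (0 : R).
  by apply: cvg_geometric; rewrite ger0_norm // ltW.
move=> /cvgrPdist_lt /(_ e e0) [M _ HM]; exists M => n /HM /=.
rewrite sub0r normrN; apply: le_lt_trans.
by rewrite (le_trans (ler_norm _)) // !normrM normr_id.
Qed.

End Expansion.

(** * Walks in a graph *)

Section Walks.
Variables (T : eqType) (e : rel T).

Lemma walk_cat x y z m n : walk e x y m -> walk e y z n -> walk e x z (m + n).
Proof.
move=> [p [ep <- <-]] [p' [ep' <- <-]]; exists (p ++ p').
by rewrite cat_path ep ep' last_cat size_cat.
Qed.

Lemma walk_split x z m n :
  walk e x z (m + n) -> exists2 y, walk e x y m & walk e y z n.
Proof.
move=> [p [ep lp sp]]; have mp : (m <= size p)%N by rewrite sp leq_addr.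
move: ep lp; rewrite -(cat_take_drop m p) cat_path last_cat => /andP[e1 e2] lp.
exists (last x (take m p)); first by exists (take m p); rewrite size_takel.
by exists (drop m p); rewrite size_drop sp addKn.
Qed.

Lemma walk_sym x y n : symmetric e -> walk e x y n -> walk e y x n.
Proof.
move=> se [p [ep lp sp]]; exists (rev (belast x p)); split.
- by rewrite -lp rev_path; under eq_path => ? ? do rewrite se.
- by case: p ep lp sp => //= a p _ _ _; rewrite rev_cons last_rcons.
- by rewrite size_rev size_belast.
Qed.

Lemma graph_dist_le x y n : walk e x y n -> (graph_dist e x y <= n)%N.
Proof.
move=> w; rewrite /graph_dist; case: pselect => [h|]; last first.
  by case; exists n; exact/asboolP.
by case: ex_minnP => m _ /(_ n); apply; exact/asboolP.
Qed.

Lemma walk_graph_dist x y n : walk e x y n -> walk e x y (graph_dist e x y).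
Proof.
move=> w; rewrite /graph_dist; case: pselect => [h|]; last first.
  by case; exists n; exact/asboolP.
by case: ex_minnP => m /asboolP.
Qed.

End Walks.

(** * Words, digits and centers of vertices *)

Section Words.
Variables (R : realType) (d N : nat).
Variables (A : 'M[int]_d.+1) (D : 'I_N -> 'cV[int]_d.+1).
Local Notation B := (real_mx R A).
Local Notation vertex := (vertex R A D).
Local Notation word_map := (@word_map R d.+1 N A D).
Hypothesis uB : B \in unitmx.

(** The integral vector [d_u] for which the word map of [u] is
[x |-> B ^- |u| *m (x + d_u)]. *)
Fixpoint word_digit (u : seq 'I_N) : 'cV[int]_d.+1 :=
  if u is i :: u' then A ^+ size u' *m D i + word_digit u' else 0.

Lemma expansion_inj n : injective (fun x : 'cV[R]_d.+1 => B ^+ n *m x).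
Proof.
move=> x y /(congr1 (mulmx (B ^- n))).
by rewrite !mulmxA !mulmxE mulVr ?unitrX // !mul1mx.
Qed.

Lemma expansion_word_map u x :
  B ^+ size u *m word_map u x = x + real_mx R (word_digit u).
Proof.
elim: u x => [|i u IH] x /=.
  by rewrite expr0 mul1mx /real_mx raddf0 addr0.
rewrite exprSr -mulmxE -mulmxA /ifs_map [B *m _]mulmxA mulmxV // mul1mx mulmxDr IH.
rewrite /real_mx map_mxD map_mxM /= rmorphXn /=.
by rewrite -addrA; congr (_ + _); rewrite addrC.
Qed.

Lemma expansion_word_mapB u x y :
  B ^+ size u *m (word_map u x - word_map u y) = x - y.
Proof. by rewrite mulmxBr !expansion_word_map opprD addrACA subrr addr0. Qed.

Lemma word_map_cat u v : word_map (u ++ v) = word_map u \o word_map v.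
Proof. by elim: u => [//|i u IH] /=; rewrite IH. Qed.

Lemma word_map_eq u v x y : size u = size v ->
  x + real_mx R (word_digit u) = y + real_mx R (word_digit v) ->
  word_map u x = word_map v y.
Proof.
move=> uv e; apply: (@expansion_inj (size u)).
by rewrite {2}uv !expansion_word_map.
Qed.

Lemma word_class_eqP u v :
  word_class R A D u = word_class R A D v <->
  size u = size v /\ word_map u = word_map v.
Proof.
rewrite /word_class; split.
  by move/eqmodP => /andP[/eqP ? /asboolP].
by move=> [suv muv]; apply/eqmodP/andP; rewrite suv; split => //; apply/asboolP.
Qed.

Definition level (x : vertex) : nat := size (repr x).

Lemma repr_class x : word_class R A D (repr x) = x.
Proof. exact: reprK. Qed.

Lemma level_class u : level (word_class R A D u) = size u.
Proof. by have /word_class_eqP[] := repr_class (word_class R A D u). Qed.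

Definition center (p : 'cV[R]_d.+1) (x : vertex) := word_map (repr x) p.

Lemma center_class p u : center p (word_class R A D u) = word_map u p.
Proof. by rewrite /center; have /word_class_eqP[_ ->] := repr_class (word_class R A D u). Qed.

End Words.

(** * Distances in the graph of the iterated function system *)

Section Horizontal.
Variables (R : realType) (d N : nat).
Variables (A : 'M[int]_d.+1) (D : 'I_N -> 'cV[int]_d.+1).
Variables (J K : set 'cV[R]_d.+1) (p : 'cV[R]_d.+1) (C rho b : R).
Local Notation B := (real_mx R A).
Local Notation vertex := (vertex R A D).
Local Notation word_map := (@word_map R d.+1 N A D).
Local Notation word_class := (word_class R A D).
Local Notation E := (ifs_graph A D J).
Local Notation o := (root_vertex R A D).
Local Notation level := (@level R d N A D).
Local Notation center := (@center R d N A D p).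
Local Notation digit := (word_digit A D).
Hypothesis expB : expands_with B C rho.
Hypothesis J_neq0 : J !=set0.
Hypothesis J_compact : compact J.
Hypothesis J_stable : forall i : 'I_N, ifs_map A D i @` J `<=` J.
Hypothesis K_stable : forall i : 'I_N, ifs_map A D i @` K `<=` K.
Hypothesis Kp : K p.
Hypothesis J_le : forall x, J x -> `|x| <= b.
Hypothesis K_le : forall x, K x -> `|x| <= b.

Let uB : B \in unitmx. Proof. by case: expB. Qed.
Let C0 : 0 < C. Proof. by case: expB. Qed.
Let rho0 : 0 < rho. Proof. by case: expB => _ _ /andP[]. Qed.
Let rho1 : rho < 1. Proof. by case: expB => _ _ /andP[]. Qed.
Let b0 : 0 <= b. Proof. exact: le_trans (normr_ge0 _) (K_le Kp). Qed.

Lemma word_map_stable (S : set 'cV[R]_d.+1) u x :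
  (forall i : 'I_N, ifs_map A D i @` S `<=` S) -> S x -> S (word_map u x).
Proof.
by move=> SS Sx; elim: u => [//|i u IH]; apply: (SS i); exists (word_map u x).
Qed.

Lemma ifs_graph_sym : symmetric E.
Proof.
suff h x y : E x y -> E y x by move=> x y; apply/idP/idP; exact: h.
move=> /asboolP[[u [v [l [ux vy uv]]]]|[u [v [[u0 suv] ux vy xy [z [[s Js sz] [t Jt tz]]]]]]].
  by apply/asboolP; left; exists v, u, l; split=> //; case: uv; [right|left].
apply/asboolP; right; exists v, u; split => //; first by rewrite -suv.
  exact/nesym.
by exists z; split; [exists t|exists s].
Qed.

Lemma word_map_rcons u l x : word_map (rcons u l) x = word_map u (ifs_map A D l x).
Proof. by rewrite -cats1 word_map_cat. Qed.

Lemma edge_level x y : E x y -> (level y <= (level x).+1)%N.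
Proof.
move=> /asboolP[[u [v [l [<- <- [->|->]]]]]|[u [v [[_ suv] <- <- _ _]]]];
  rewrite !level_class ?size_rcons ?suv //; exact: leqW.
Qed.

(** A bound for the displacement of the center along an edge, seen from the level
of its first vertex; the factor with [B] accounts for the edges that go up. *)
Definition edge_width : R := (d.+1%:R * `|B| + 1) * (b + b).

Let edge_width_ge (M : 'M[R]_d.+1) (x y : 'cV[R]_d.+1) : `|M| <= `|B| \/ M = 1%:M ->
  `|x| <= b -> `|y| <= b -> `|M *m (x - y)| <= edge_width.
Proof.
move=> MB xb yb; have xyb : `|x - y| <= b + b.
  by rewrite (le_trans (ler_normB _ _)) // lerD.
rewrite /edge_width mulrDl mul1r.
have h0 : 0 <= d.+1%:R * `|B| * (b + b) by rewrite !mulr_ge0 // addr_ge0.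
case: MB => [MB|->]; last by rewrite mul1mx (le_trans xyb) // lerDr.
rewrite (le_trans (norm_mulmx_le _ _)) //.
apply: (@le_trans _ _ (d.+1%:R * `|B| * (b + b))); last by rewrite lerDl addr_ge0.
by rewrite ler_pM ?mulr_ge0 // ler_wpM2l.
Qed.

Lemma edge_center x y :
  E x y -> `|B ^+ level x *m (center x - center y)| <= edge_width.
Proof.
have KS i z : K z -> K (ifs_map A D i z) by move=> Kz; apply: (K_stable (i := i)); exists z.
move=> /asboolP[[u [v [l [<- <- [->|->]]]]]|[u [v [[_ suv] <- <- _ [z [[s Js sz] [t Jt tz]]]]]]].
- rewrite level_class !center_class word_map_rcons expansion_word_mapB //.
  rewrite -[_ - _]mul1mx; apply: edge_width_ge; [by right|exact: K_le|].
  exact/K_le/KS.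
- rewrite level_class !center_class word_map_rcons size_rcons exprS -mulmxE.
  rewrite -mulmxA expansion_word_mapB //.
  by apply: edge_width_ge; [left|exact/K_le/KS|exact: K_le].
- rewrite level_class !center_class.
  have -> : word_map u p - word_map v p =
      (word_map u p - word_map u s) - (word_map v p - word_map v t).
    by rewrite sz tz opprB addrA subrK.
  rewrite mulmxBr expansion_word_mapB // suv expansion_word_mapB //.
  rewrite opprB addrC addrA subrK -[_ - _]mul1mx.
  by apply: edge_width_ge; [right|exact: J_le|exact: J_le].
Qed.

(** The level drops by at most one at each step, so the [t]-th step from the end
starts at level at least [k + t]; seen from level [k] it has size at most
[C * edge_width * rho ^+ t].  The bound comes from this geometric series. *)
Lemma descending_walk i x z k : walk E x z i -> (i + k <= level x)%N ->
  (1 - rho) * `|B ^+ k *m (center x - center z)|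
    <= C * edge_width * (1 - rho ^+ i).
Proof.
have w0 : 0 <= edge_width by rewrite /edge_width mulr_ge0 ?addr_ge0 ?mulr_ge0.
elim: i x => [|i IH] x.
  move=> [[|? ?] [_ <- //= _]] _.
  by rewrite subrr mulmx0 normr0 expr0 subrr !mulr0.
move=> w ik; have /walk_split : walk E x z (1 + i) by [].
move=> [y [[|a [|? ?]] [//= /andP[xa _] <- _]]] az.
have ax : (level x <= (level a).+1)%N by apply: edge_level; rewrite ifs_graph_sym.
have ika : (i + k <= level a)%N by rewrite -ltnS (leq_trans _ ax).
have {IH}ha := IH a az ika.
have -> : center x - center z = (center x - center a) + (center a - center z).
  by rewrite addrA subrK.
rewrite mulmxDr (le_trans (ler_wpM2l _ (ler_normD _ _))) ?subr_ge0 ?(ltW rho1) //.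
rewrite mulrDr (le_trans (lerD (lexx _) ha)) //.
have kx : (k <= level x)%N by rewrite (leq_trans _ ik) // leq_addl.
have hx : `|B ^+ k *m (center x - center a)| <= C * edge_width * rho ^+ i.
  rewrite (le_trans (expands_with_le _ expB kx)) // mulrAC ler_pM //.
  - by rewrite mulr_ge0 // ltW.
  - by rewrite exprn_ge0 // ltW.
  - by rewrite ler_wpM2l ?(ltW C0) // edge_center.
  - rewrite ler_wiXn2l ?(ltW rho0) ?(ltW rho1) //.
    by rewrite leq_subRL // (leq_trans _ ik) // addnC leq_add2r.
have := ler_wpM2l (_ : 0 <= 1 - rho) hx; rewrite subr_ge0 => /(_ (ltW rho1)) hx'.
rewrite (le_trans (lerD hx' (lexx _))) // exprS le_eqVlt; apply/orP; left.
by apply/eqP; ring.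
Qed.

(** Twice the full geometric series of [descending_walk]. *)
Definition walk_width : R := 2 * C * edge_width / (1 - rho).

(** The walk is cut after [level x - k] steps, or at its end if it is shorter: both
parts, read from [x] and from [y], are covered by [descending_walk]. *)
Lemma walk_center x y l k : walk E x y l ->
  (k <= level x)%N -> (k <= level y)%N -> (l + 2 * k <= level x + level y)%N ->
  `|B ^+ k *m (center x - center y)| <= walk_width.
Proof.
move=> w kx ky lk.
have w0 : 0 <= edge_width by rewrite /edge_width mulr_ge0 ?addr_ge0 ?mulr_ge0.
pose i := minn l (level x - k).
have il : (i + (l - i) = l)%N by rewrite subnKC // geq_minl.
move: (w); rewrite -il => /walk_split[z wx wy].
have hx : (i + k <= level x)%N by rewrite /i; lia.
have hy : (l - i + k <= level y)%N by rewrite /i; lia.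
have step j : C * edge_width * (1 - rho ^+ j) <= C * edge_width.
  rewrite ler_piMr //; first exact: mulr_ge0 (ltW C0) w0.
  by rewrite gerBl exprn_ge0 // ltW.
have {hx}hx := le_trans (descending_walk wx hx) (step _).
have {hy}hy := le_trans (descending_walk (walk_sym ifs_graph_sym wy) hy) (step _).
have -> : center x - center y = (center x - center z) - (center y - center z).
  by rewrite opprB addrA subrK.
rewrite /walk_width ler_pdivlMr ?subr_gt0 // mulmxBr mulrC.
rewrite (le_trans (ler_wpM2l _ (ler_normB _ _))) ?subr_ge0 ?(ltW rho1) //.
by rewrite mulrDr (le_trans (lerD hx hy)) // -mulrA -mulr2n mulr_natl.
Qed.

Lemma walk_ancestor u v : walk E (word_class (u ++ v)) (word_class u) (size v).
Proof.
elim/last_ind: v => [|v l IH]; first by rewrite cats0; exists [::].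
rewrite size_rcons; apply: (@walk_cat _ _ _ _ _ 1 (size v) _ IH).
exists [:: word_class (u ++ v)]; split=> //=; rewrite andbT.
apply/asboolP; left; exists (rcons (u ++ v) l), (u ++ v), l.
by split; rewrite ?rcons_cat //; right.
Qed.

Lemma walk_level x y n : walk E x y n -> (level y <= level x + n)%N.
Proof.
move=> [s [+ <- <-]]; elim: s x => [|a s IH] x; first by rewrite addn0.
move=> /= /andP[/edge_level xa /IH h]; rewrite (leq_trans h) // addnS -addSn.
by rewrite leq_add2r.
Qed.

Lemma walk_root x : walk E x o (level x).
Proof.
by have := walk_ancestor [::] (repr x); rewrite cat0s repr_class.
Qed.

Lemma graph_dist_root x : graph_dist E o x = level x.
Proof.
have w := walk_sym ifs_graph_sym (walk_root x).
apply/eqP; rewrite eqn_leq graph_dist_le //=.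
by have := walk_level (walk_graph_dist w); rewrite /o level_class.
Qed.

Lemma vertex_walk x y : exists n, walk E x y n.
Proof.
exists (level x + level y)%N; apply: walk_cat (walk_root x) _.
exact/(walk_sym ifs_graph_sym)/walk_root.
Qed.

Lemma graph_dist_walk x y : walk E x y (graph_dist E x y).
Proof. by have [n /walk_graph_dist] := vertex_walk x y. Qed.

Lemma J_differences_closed : closed [set st.1 - st.2 | st in J `*` J].
Proof.
apply: compact_closed; first exact: norm_hausdorff.
apply: continuous_compact; last exact: compact_setX.
apply: continuous_subspaceT => -[s t]; apply: cvgB; [exact: cvg_fst|exact: cvg_snd].
Qed.

(** Each integral vector outside the closed set [J - J] is at a positive distance
from it, and only finitely many integral vectors come into question, because
[J - J] is bounded. *)
Lemma integral_difference_near c : 0 <= c -> exists M, forall z : 'cV[int]_d.+1,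
  (exists s t, [/\ J s, J t & `|real_mx R z - (s - t)| <= C * rho ^+ M * c]) ->
  exists s t, [/\ J s, J t & real_mx R z = s - t].
Proof.
move=> c0.
have ex z : exists M, forall n, (M <= n)%N ->
    (exists s t, [/\ J s, J t & `|real_mx R z - (s - t)| <= C * rho ^+ n * c]) ->
    exists s t, [/\ J s, J t & real_mx R z = s - t].
  have [[[s t] /= [Js Jt] <-]|zJ] := pselect ([set st.1 - st.2 | st in J `*` J] (real_mx R z)).
    by exists 0%N => n _ _; exists s, t.
  have : \forall y \near real_mx R z, (~` [set st.1 - st.2 | st in J `*` J]) y.
    by apply: open_nbhs_nbhs; split => //; exact/closed_openC/J_differences_closed.
  move=> /nbhs_normP[e /= e0 He].
  have [M HM] := @geometric_small R rho (C * c) e (introT andP (conj rho0 rho1)) e0.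
  exists M => n /HM ne [s [t [Js Jt st]]]; exfalso.
  apply: (He (s - t)); last by exists (s, t).
  by rewrite /= (le_lt_trans st) // mulrAC.
pose L := (Num.truncn (b + b + C * c)).+1.
(* the integral vectors with entries between [- L] and [L] *)
pose dec (f : {ffun 'I_d.+1 -> 'I_(L + L).+1}) : 'cV[int]_d.+1 :=
  \col_i ((f i)%:Z - L%:Z).
pose Mz z := sval (cid (ex z)).
exists (\max_(f : {ffun 'I_d.+1 -> 'I_(L + L).+1}) Mz (dec f))%N => z near_z.
have zL i : (`|z i ord0| <= L)%N.
  have [s [t [Js Jt st]]] := near_z.
  rewrite -(ler_nat R) natr_absz intr_norm.
  have -> : (z i ord0)%:~R = (real_mx R z) i ord0 by rewrite mxE.
  rewrite (le_trans (norm_entry_le _ _ _)) // (le_trans _ (ltW (truncnS_gt _))) //.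
  rewrite -[real_mx R z](subrK (s - t)) addrC (le_trans (ler_normD _ _)) // lerD //.
    by rewrite (le_trans (ler_normB _ _)) // lerD // J_le.
  rewrite (le_trans st) // ler_wpM2r // ler_piMr ?(ltW C0) //.
  by rewrite exprn_ile1 // ltW.
have [f fz] : exists f, z = dec f.
  exists [ffun i => inord (absz (z i ord0 + L%:Z))].
  apply/colP => i; rewrite !mxE ffunE -[0]/ord0.
  by move: (z i ord0) (zL i) => y yL; rewrite inordK; lia.
apply: (svalP (cid (ex z))) near_z.
by rewrite -/(Mz z) fz; exact: (leq_bigmax f).
Qed.

(** If two descendants are close at their own scale, then, [M] levels higher, the
difference of the digits of the ancestors is a difference of points of [J] up to
[O(rho ^+ M)]; by [integral_difference_near] it is exactly one, and this is
what a horizontal edge asks for. *)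
Lemma horizontal_ancestors c : 0 <= c -> exists M, forall u u' v v',
  size u = size v -> (M <= size u')%N -> (M <= size v')%N ->
  `|B ^+ (size u + M) *m (word_map (u ++ u') p - word_map (v ++ v') p)| <= c ->
  exists2 n, (n <= 1)%N & walk E (word_class u) (word_class v) n.
Proof.
move=> c0; have [q Jq] := J_neq0.
have c'0 : 0 <= c + (b + b) + (b + b) by rewrite !addr_ge0.
have [M HM] := integral_difference_near c'0.
exists M => u u' v v' uv Mu Mv close.
have [s [t [Js Jt st]]] : exists s t,
    [/\ J s, J t & real_mx R (digit v - digit u) = s - t].
  apply: HM; exists (word_map u' q), (word_map v' q).
  split; [exact: word_map_stable|exact: word_map_stable|].
  set z := real_mx R _.
  have zE : word_map u' p - word_map v' p - z =
      B ^+ size u *m (word_map (u ++ u') p - word_map (v ++ v') p).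
    rewrite !word_map_cat /= mulmxBr expansion_word_map // uv expansion_word_map //.
    by rewrite /z real_mxB; apply/matrixP => i j; rewrite !mxE; ring.
  have hz : `|word_map u' p - word_map v' p - z| <= C * rho ^+ M * c.
    have [_ _ _ Bx] := expB; rewrite (le_trans (Bx M _)) // zE mulmxA mulmxE -exprD.
    by rewrite ler_wpM2l ?mulr_ge0 ?(ltW C0) ?exprn_ge0 ?(ltW rho0) // addnC.
  have hw w : (M <= size w)%N -> `|word_map w p - word_map w q| <= C * rho ^+ M * (b + b).
    move=> Mw; have [_ _ _ Bx] := expB; rewrite (le_trans (Bx (size w) _)) //.
    have rn n : 0 <= rho ^+ n by rewrite exprn_ge0 // ltW.
    have Cr n : 0 <= C * rho ^+ n by rewrite mulr_ge0 // ltW.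
    rewrite expansion_word_mapB // ler_pM //.
      by rewrite ler_wpM2l ?(ltW C0) // ler_wiXn2l // ltW.
    by rewrite (le_trans (ler_normB _ _)) // lerD ?(K_le Kp) ?(J_le Jq).
  have -> : z - (word_map u' q - word_map v' q) =
      (word_map u' p - word_map u' q) - (word_map v' p - word_map v' q)
      - (word_map u' p - word_map v' p - z).
    by apply/matrixP => i j; rewrite !mxE; ring.
  rewrite (le_trans (ler_normB _ _)) //.
  apply: (@le_trans _ _ (C * rho ^+ M * ((b + b) + (b + b)) + C * rho ^+ M * c)); last first.
    by rewrite -mulrDr addrC addrA.
  rewrite lerD //.
  by rewrite (le_trans (ler_normB _ _)) // mulrDr lerD // hw.
have uvst : word_map u s = word_map v t.
  apply: word_map_eq => //; apply/matrixP => i j.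
  by move/matrixP: st => /(_ i j); rewrite real_mxB !mxE; lra.
have [->|/eqP uv_neq] := eqVneq (word_class u) (word_class v).
  by exists 0%N => //; exists [::].
exists 1%N => //; exists [:: word_class v]; split=> //=; rewrite andbT.
apply/asboolP; right; exists u, v; split=> //.
  split=> //; case: (u) uv uv_neq => //= /esym/size0nil -> /(_ erefl) [].
by exists (word_map u s); split; [exists s|exists t].
Qed.

(** Together with [walk_center] this determines the distance up to a bounded
error: climb from both vertices to the level [k - M] given by
[horizontal_ancestors], and cross there. *)
Lemma close_centers_dist c : 0 <= c -> exists m, forall x y k,
  (k <= level x)%N -> (k <= level y)%N ->
  `|B ^+ k *m (center x - center y)| <= c ->
  (graph_dist E x y + 2 * k <= level x + level y + m)%N.
Proof.
move=> c0; have [M HM] := horizontal_ancestors c0; exists (2 * M + 1)%N => x y k.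
move: (repr_class x) (repr_class y) => <- <-.
move: (repr x) (repr y) => u v; rewrite !level_class !center_class => ku kv close.
pose j := (k - M)%N.
have su : size (take j u) = j by rewrite size_takel // /j; lia.
have sv : size (take j v) = j by rewrite size_takel // /j; lia.
have [n n1 w] : exists2 n, (n <= 1)%N &
    walk E (word_class (take j u)) (word_class (take j v)) n.
  (* for [k < M] both ancestors are taken at level 0, where they are the root *)
  have [kM|Mk] := leqP M k; last first.
    exists 0%N => //; rewrite (_ : j = 0%N) ?take0; last by rewrite /j; lia.
    by exists [::].
  apply: (HM _ (drop j u) _ (drop j v)).
  - by rewrite su sv.
  - by rewrite size_drop /j; lia.
  - by rewrite size_drop /j; lia.
  - by rewrite !cat_take_drop su subnK.
have wu := walk_ancestor (take j u) (drop j u).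
have wv := walk_sym ifs_graph_sym (walk_ancestor (take j v) (drop j v)).
move: wu wv; rewrite !cat_take_drop !size_drop => wu wv.
have := graph_dist_le (walk_cat (walk_cat wu w) wv).
by move: (graph_dist _ _ _) => g; rewrite /j; lia.
Qed.

End Horizontal.

(** * The Gromov product of two vertices *)

Section GromovProduct.
Variables (R : realType) (d N : nat).
Variables (A : 'M[int]_d.+1) (D : 'I_N -> 'cV[int]_d.+1).
Variables (J K : set 'cV[R]_d.+1) (p : 'cV[R]_d.+1) (C rho b : R).
Local Notation B := (real_mx R A).
Local Notation E := (ifs_graph A D J).
Local Notation o := (root_vertex R A D).
Local Notation level := (@level R d N A D).
Local Notation center := (@center R d N A D p).
Local Notation gp := (gromov_product R E o).
Hypothesis expB : expands_with B C rho.
Hypothesis J_neq0 : J !=set0.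
Hypothesis J_compact : compact J.
Hypothesis J_stable : forall i : 'I_N, ifs_map A D i @` J `<=` J.
Hypothesis K_stable : forall i : 'I_N, ifs_map A D i @` K `<=` K.
Hypothesis Kp : K p.
Hypothesis J_le : forall x, J x -> `|x| <= b.
Hypothesis K_le : forall x, K x -> `|x| <= b.

Lemma gromov_product_level x y : gp x y =
  ((level x)%:R + (level y)%:R - (graph_dist E x y)%:R) / 2.
Proof. by rewrite /gromov_product !graph_dist_root. Qed.

Lemma gromov_product_self x : gp x x = (level x)%:R.
Proof.
have : walk E x x 0 by exists [::].
move=> /graph_dist_le; rewrite gromov_product_level leqn0 => /eqP ->.
by lra.
Qed.

Lemma level_le_dist x y : (level x <= level y + graph_dist E x y)%N.
Proof.
exact/walk_level/(walk_sym (ifs_graph_sym _))/graph_dist_walk.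
Qed.

Lemma gromov_product_le x y : gp x y <= (level y)%:R.
Proof.
have := level_le_dist x y; rewrite -(ler_nat R) natrD gromov_product_level; lra.
Qed.

Lemma gromov_product_sym x y : gp x y = gp y x.
Proof.
rewrite !gromov_product_level; congr ((_ - _%:R) / 2); first by rewrite addrC.
apply/eqP; rewrite eqn_leq !graph_dist_le //;
  exact/(walk_sym (ifs_graph_sym _))/graph_dist_walk.
Qed.

Lemma gromov_product_ge0 x y : 0 <= gp x y.
Proof.
rewrite gromov_product_level divr_ge0 // subr_ge0 -natrD ler_nat.
apply: graph_dist_le; apply: walk_cat (walk_root _ _) _.
exact/(walk_sym (ifs_graph_sym _))/walk_root.
Qed.

Lemma gromov_product_close x y k : k%:R <= gp x y ->
  [/\ (k <= level x)%N, (k <= level y)%N &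
      `|B ^+ k *m (center x - center y)| <= walk_width A C rho b].
Proof.
move=> kxy.
have ky : (k <= level y)%N by rewrite -(ler_nat R) (le_trans kxy) ?gromov_product_le.
have kx : (k <= level x)%N.
  by rewrite -(ler_nat R) (le_trans kxy) // gromov_product_sym gromov_product_le.
split=> //; apply: (walk_center expB K_stable Kp J_le K_le (graph_dist_walk _ x y)) => //.
move: kxy; rewrite gromov_product_level ler_pdivlMr // lerBrDr.
by rewrite -natrM -!natrD ler_nat mulnC addnC.
Qed.

Lemma close_gromov_product c : 0 <= c -> exists m : nat, forall x y k,
  (k <= level x)%N -> (k <= level y)%N ->
  `|B ^+ k *m (center x - center y)| <= c -> k%:R - m%:R <= gp x y.
Proof.
move=> c0.
have [m Hm] := close_centers_dist expB J_neq0 J_compact J_stable Kp J_le K_le c0.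
exists m => x y k kx ky kc; have := Hm x y k kx ky kc.
rewrite gromov_product_level ler_pdivlMr // -(ler_nat R) natrD natrM !natrD => h.
have : 0 <= m%:R :> R by []. 
lra.
Qed.

(** Follow an address of [x]: the [n]-th vertex is the class of its first [n]
letters, and [x] lies in the image of [K] under the corresponding word map. *)
Lemma limit_of_vertices (K_invariant : K = \bigcup_(i in [set: 'I_N]) (ifs_map A D i @` K)) x :
  K x -> exists s : nat -> vertex R A D,
    (forall k, \forall n \near \oo, (k <= level (s n))%N) /\
    center (s n) @[n --> \oo] --> x.
Proof.
move=> Kx.
have KP y : K y -> exists iz : 'I_N * 'cV[R]_d.+1, K iz.2 /\ y = ifs_map A D iz.1 iz.2.
  by rewrite {1}K_invariant => -[i _ [z Kz <-]]; exists (i, z).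
have next y : exists iz : 'I_N * 'cV[R]_d.+1, K y -> K iz.2 /\ y = ifs_map A D iz.1 iz.2.
  have [/KP[iz hiz]|nKy] := pselect (K y); first by exists iz.
  by have [[i _] _] := KP _ Kx; exists (i, y).
pose f y := sval (cid (next y)).
pose g y := (f y).2.
have fP y : K y -> K (g y) /\ y = ifs_map A D (f y).1 (g y).
  exact: (svalP (cid (next y))).
pose u n := [seq (f (iter m g x)).1 | m <- iota 0 n].
have uP n : K (iter n g x) /\ x = word_map A D (u n) (iter n g x).
  elim: n => [//|n [Kn xn]]; have [Kgn gn] := fP _ Kn; split=> //.
  have -> : u n.+1 = rcons (u n) (f (iter n g x)).1.
    by rewrite /u -[n.+1]addn1 iotaD map_cat cats1.
  by rewrite word_map_rcons /= -gn.
exists (fun n => word_class R A D (u n)); split.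
  by move=> k; exists k => // n /= kn; rewrite level_class size_map size_iota.
apply/cvgrPdist_lt => e e0.
have [uB C0 /andP[r0 r1] Bx] := expB.
have [M HM] := geometric_small (C * (b + b)) (introT andP (conj r0 r1)) e0.
exists M => // n /= /HM; apply: le_lt_trans.
have [Kn xn] := uP n.
rewrite center_class {1}xn (le_trans (Bx n _)) //.
have szu : size (u n) = n by rewrite size_map size_iota.
rewrite -[X in B ^+ X]szu.
rewrite expansion_word_mapB //.
rewrite mulrAC ler_wpM2r ?exprn_ge0 ?(ltW r0) // ler_wpM2l ?(ltW C0) //.
by rewrite (le_trans (ler_normB _ _)) // lerD ?(K_le Kn) ?(K_le Kp).
Qed.

End GromovProduct.

(** * Hyperbolicity and the hyperbolic boundary *)

Section Boundary.
(** Only the comparison of the Gromov product with the distance of dilated centers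
matters here, so the graph is an abstract one with levels and centers. *)
Variables (R : realType) (d : nat) (B : 'M[R]_d.+1) (C rho W b : R).
Variables (T : eqType) (E : rel T) (o : T) (level : T -> nat).
Variables (center : T -> 'cV[R]_d.+1) (K : set 'cV[R]_d.+1).
Local Notation gp := (gromov_product R E o).
Hypothesis expB : expands_with B C rho.
Hypothesis gp_ge0 : forall x y, 0 <= gp x y.
Hypothesis gp_self : forall x, gp x x = (level x)%:R.
Hypothesis gp_le : forall x y, gp x y <= (level y)%:R.
Hypothesis gp_sym : forall x y, gp x y = gp y x.
Hypothesis gp_close : forall x y k, k%:R <= gp x y ->
  [/\ (k <= level x)%N, (k <= level y)%N & `|B ^+ k *m (center x - center y)| <= W].
Hypothesis close_gp : forall c, 0 <= c -> exists m : nat, forall x y k,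
  (k <= level x)%N -> (k <= level y)%N ->
  `|B ^+ k *m (center x - center y)| <= c -> k%:R - m%:R <= gp x y.

Let C0 : 0 < C. Proof. by case: expB. Qed.
Let rho0 : 0 < rho. Proof. by case: expB => _ _ /andP[]. Qed.
Let rho1 : rho < 1. Proof. by case: expB => _ _ /andP[]. Qed.
Let W0 : 0 <= W.
Proof. by have [_ _] := gp_close (gp_ge0 o o : 0%N%:R <= gp o o); apply: le_trans. Qed.

(** Being close at level [k] is transitive up to doubling the bound, where [k] is
the integral part of the smaller of the two given Gromov products; passing to the
integral part costs 1. *)
Lemma hyperbolic_of_centers : hyperbolic R E o.
Proof.
have [m Hm] := close_gp (addr_ge0 W0 W0).
exists (1 + m%:R); split=> [|x y z]; first by rewrite addr_ge0.
set g := Num.min _ _; have g0 : 0 <= g by rewrite le_min !gp_ge0.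
have /andP[kg gk] := truncn_itv g0; set k := Num.truncn g in kg gk.
have /gp_close[kx _ kxz] : k%:R <= gp x z by rewrite (le_trans kg) // ge_min lexx.
have /gp_close[_ ky kzy] : k%:R <= gp z y by rewrite (le_trans kg) // ge_min lexx orbT.
have hk : k%:R - m%:R <= gp x y.
  apply: Hm => //; have -> : center x - center y = (center x - center z) + (center z - center y).
    by rewrite addrA subrK.
  by rewrite mulmxDr (le_trans (ler_normD _ _)) // lerD.
by move: gk hk; rewrite -natr1; lra.
Qed.

(** These sets turn out to be the points of the hyperbolic boundary. *)
Definition sequences_to (x : 'cV[R]_d.+1) : set (nat -> T) :=
  [set s | (forall k, \forall n \near \oo, (k <= level (s n))%N) /\
           center (s n) @[n --> \oo] --> x].

Definition gromov_cauchy (s t : nat -> T) : Prop :=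
  forall k : nat, exists M, forall m n, (M <= m)%N -> (M <= n)%N -> k%:R <= gp (s m) (t n).

Lemma sequences_to_inj s x y : sequences_to x s -> sequences_to y s -> x = y.
Proof. by move=> [_ sx] [_ sy]; apply: cvg_unique sx sy; exact: norm_hausdorff. Qed.

Lemma dilated_limit s t x y k e : sequences_to x s -> sequences_to y t -> 0 < e ->
  exists M, forall m n, (M <= m)%N -> (M <= n)%N ->
    `|B ^+ k *m (center (s m) - center (t n)) - B ^+ k *m (x - y)| <= e.
Proof.
move=> [_ sx] [_ ty] e0; pose c := d.+1%:R * `|B ^+ k|.
have c0 : 0 <= c by rewrite mulr_ge0.
have e'0 : 0 < e / (c + 1) / 2 by rewrite !divr_gt0 // ltr_wpDl.
move: sx ty => /cvgrPdist_le/(_ _ e'0)[M1 _ HM1] /cvgrPdist_le/(_ _ e'0)[M2 _ HM2].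
exists (maxn M1 M2) => m n; rewrite !geq_max => /andP[m1 _] /andP[_ n2].
rewrite -mulmxBr (le_trans (norm_mulmx_le _ _)) // -/c.
have h : `|center (s m) - center (t n) - (x - y)| <= e / (c + 1).
  have -> : center (s m) - center (t n) - (x - y) =
      (y - center (t n)) - (x - center (s m)).
    by apply/matrixP => i j; rewrite !mxE; ring.
  rewrite (le_trans (ler_normB _ _)) // [leRHS]splitr lerD //; [exact: HM2|exact: HM1].
apply: (@le_trans _ _ ((c + 1) * (e / (c + 1)))); last by rewrite mulrC divfK // gt_eqF // ltr_wpDl.
by rewrite ler_pM // lerDl.
Qed.

Lemma sequences_to_gromov_cauchy s t x :
  sequences_to x s -> sequences_to x t -> gromov_cauchy s t.
Proof.
move=> sx tx k; have [m Hm] := close_gp (ler01 : 0 <= 1 :> R).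
have [M1 HM1] := dilated_limit (k + m) sx tx ltr01.
have [M2 _ HM2] := sx.1 (k + m)%N; have [M3 _ HM3] := tx.1 (k + m)%N.
exists (maxn M1 (maxn M2 M3)) => i j; rewrite !geq_max => /and3P[i1 i2 i3] /and3P[j1 j2 j3].
have -> : k%:R = (k + m)%:R - m%:R :> R by rewrite natrD addrK.
apply: Hm; [exact: HM2|exact: HM3|].
by have := HM1 i j i1 j1; rewrite subrr mulmx0 subr0.
Qed.

Lemma gromov_cauchy_close s t k : gromov_cauchy s t ->
  exists M, forall m n, (M <= m)%N -> (M <= n)%N ->
    (k <= level (s m))%N /\ `|center (s m) - center (t n)| <= C * rho ^+ k * W.
Proof.
move=> st; have [M HM] := st k; exists M => m n Mm Mn.
have [ks _ kst] := gp_close (HM m n Mm Mn); split=> //.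
have [_ _ _ Bx] := expB; rewrite (le_trans (Bx k _)) // ler_wpM2l //.
by rewrite mulr_ge0 ?(ltW C0) // exprn_ge0 // ltW.
Qed.

Lemma gromov_cauchy_cvg s : gromov_cauchy s s -> exists x, sequences_to x s.
Proof.
move=> sC.
have /cauchy_cvgP/cvg_ex[x sx] : cauchy (center (s n) @[n --> \oo]).
  apply: cauchy_exP => e e0.
  have [k Hk] := geometric_small (C * W) (introT andP (conj rho0 rho1)) e0.
  have [M HM] := gromov_cauchy_close k sC.
  exists (center (s M)), M => // n /= Mn; rewrite -ball_normE /=.
  have [_ sMn] := HM M n (leqnn M) Mn; rewrite (le_lt_trans sMn) //.
  by rewrite mulrAC Hk.
exists x; split=> // k; have [M HM] := gromov_cauchy_close k sC.
by exists M => // n /= Mn; have [] := HM n n Mn Mn.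
Qed.

Section Visual.
Variable a : R.
Hypothesis a0 : 0 < a.
Local Notation vis := (visual_metric E o a).

Lemma visual_metric_le x y k : k <= gp x y -> vis x y <= expR (- a * k).
Proof.
move=> kg; rewrite /visual_metric; case: eqP => _; first by rewrite mul0r expR_ge0.
by rewrite mul1r ler_expR !mulNr lerN2 ler_wpM2l // ltW.
Qed.

Lemma visual_metric_lt x y k : vis x y < expR (- a * k) -> x = y \/ k < gp x y.
Proof.
rewrite /visual_metric; case: eqP => [->|_]; first by left.
by rewrite mul1r ltr_expR !mulNr ltrN2 ltr_pM2l //; right.
Qed.

Lemma visual_metric_ge0 x y : 0 <= vis x y.
Proof. by rewrite mulr_ge0 // expR_ge0. Qed.

Lemma expR_small e : 0 < e -> exists k : nat, expR (- a * k%:R) < e.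
Proof.
move=> e0; exists (Num.truncn `|ln e / a|).+1.
rewrite -[ltRHS]lnK ?posrE // ltr_expR mulNr ltrNl.
have := truncnS_gt `|ln e / a|; rewrite -(ltr_pM2l a0) => /le_lt_trans; apply.
apply: (@le_trans _ _ (a * - (ln e / a))); first by rewrite mulrN mulrC divfK // gt_eqF.
by rewrite ler_wpM2l ?(ltW a0) // -normrN ler_norm.
Qed.

Lemma gromov_cauchy_visual s t e : gromov_cauchy s t -> 0 < e ->
  exists M, forall m n, (M <= m)%N -> (M <= n)%N -> vis (s m) (t n) < e.
Proof.
move=> st /expR_small[k ke]; have [M HM] := st k; exists M => m n Mm Mn.
exact: le_lt_trans (visual_metric_le (HM m n Mm Mn)) ke.
Qed.

(** If the Gromov products [gp (s m) (s n)] do not tend to infinity, the Cauchy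
condition provides two equal terms [s m = s n] of low level.  A vertex has Gromov
product at most its level with any other vertex, so that all later terms, being
at small visual distance from [s m], are equal to it. *)
Lemma visual_cauchy_dichotomy s : visual_cauchy E o a s ->
  (exists x M, forall n, (M <= n)%N -> s n = x) \/ exists x, sequences_to x s.
Proof.
move=> sC; have [/gromov_cauchy_cvg|] := pselect (gromov_cauchy s s); first by right.
move=> /existsNP[k /forallNP Hk]; left.
have [M HM] := sC _ (expR_gt0 (- a * k%:R)).
have : exists m n, [/\ (M <= m)%N, (M <= n)%N & gp (s m) (s n) < k%:R].
  have := Hk M; move=> /existsNP[m /existsNP[n /not_implyP[Mm /not_implyP[Mn /negP]]]].
  by rewrite -ltNge => ?; exists m, n.
move=> [m [n [Mm Mn mn]]].
have smn : s m = s n.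
  by have [//|] := visual_metric_lt (HM m n Mm Mn); rewrite ltNge (ltW mn).
exists (s m), M => j Mj; have [//|] := visual_metric_lt (HM m j Mm Mj).
move=> h; exfalso.
have := gp_le (s j) (s m); rewrite gp_sym -gp_self {2}smn => h'.
rewrite gp_sym in mn.
by have := lt_trans (lt_le_trans h h') mn; rewrite ltxx.
Qed.

(** Vertices at small visual distance are equal or have a large Gromov product;
in both cases their centers are close, which gives one inclusion.  Conversely,
sequences whose levels tend to infinity and whose centers have the same limit
are close at every scale. *)
Lemma cauchy_class_sequences_to s x :
  sequences_to x s -> cauchy_class E o a s = sequences_to x.
Proof.
move=> sx; apply/seteqP; split=> t; last first.
  move=> tx; split.
    by move=> e e0; exact: (gromov_cauchy_visual (sequences_to_gromov_cauchy tx tx) e0).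
  apply/cvgrPdist_lt => e e0.
  have [M HM] := gromov_cauchy_visual (sequences_to_gromov_cauchy sx tx) e0.
  exists M => // n /= Mn; rewrite sub0r normrN ger0_norm ?visual_metric_ge0 //.
  exact: HM.
move=> [tC st].
have stk k : \forall n \near \oo, s n = t n \/ k < gp (s n) (t n).
  move/cvgrPdist_lt : st => /(_ _ (expR_gt0 (- a * k))).
  apply: filterS => n /=; rewrite sub0r normrN ger0_norm ?visual_metric_ge0 //.
  exact: visual_metric_lt.
have [[y [M Hy]]|[y ty]] := visual_cauchy_dichotomy tC.
  exfalso; have [M1 _ HM1] := sx.1 (level y).+1; have [M2 _ HM2] := stk (level y)%:R.
  pose n := maxn M (maxn M1 M2).
  have tn : t n = y by apply: Hy; rewrite leq_maxl.
  have nM1 : (M1 <= n)%N by rewrite /n !leq_max leqnn orbT.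
  have nM2 : (M2 <= n)%N by rewrite /n !leq_max leqnn !orbT.
  have [snt|] := HM2 n nM2.
    by have := HM1 n nM1; rewrite /= snt tn ltnn.
  by rewrite tn ltNge gp_le.
suff -> : x = y by [].
apply/eqP; rewrite -subr_eq0 -normr_le0; apply/ler_addgt0Pl => e e0; rewrite addr0.
have [k Hk] := geometric_small (C * W) (introT andP (conj rho0 rho1)) e0.
have xy : `|center (s n) - center (t n)| @[n --> \oo] --> `|x - y|.
  by apply: cvg_norm; apply: cvgB; [case: sx|case: ty].
apply: (cvgr_to_le xy).
have := stk k%:R; apply: filterS => n [->|/ltW/gp_close[_ _ kst]].
  by rewrite subrr normr0 ltW.
have [_ _ _ Bx] := expB; rewrite (le_trans (Bx k _)) //.
apply: le_trans (ltW (Hk k (leqnn k))); rewrite [leRHS]mulrAC ler_wpM2l //.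
by rewrite mulr_ge0 ?(ltW C0) // exprn_ge0 // ltW.
Qed.

Hypothesis K_closed : closed K.
Hypothesis center_K : forall x, K (center x).
Hypothesis limit_of_centers : forall x, K x -> exists s, sequences_to x s.

Lemma hyperbolic_boundaryE : hyperbolic_boundary E o a = sequences_to @` K.
Proof.
have visxx x : vis x x = 0 by rewrite /visual_metric eqxx mul0r.
apply/seteqP; split=> xi.
  move=> [[s sC <-] sN]; have [[y [M Hy]]|[x sx]] := visual_cauchy_dichotomy sC.
    exfalso; apply: sN; exists y => //.
    rewrite /completion_embed /cauchy_class; apply/seteqP; split=> t [tC st]; split=> //.
      apply: cvg_trans st; apply: near_eq_cvg; exists M => // n /= /Hy -> //.
    apply: cvg_trans st; apply: near_eq_cvg; exists M => // n /= /Hy -> //.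
  exists x; last by rewrite (cauchy_class_sequences_to sx).
  apply: (closed_cvg _ K_closed _ _ sx.2); exact: nearW.
move=> [x Kx <-]; have [s sx] := limit_of_centers Kx; split.
  exists s; last exact: cauchy_class_sequences_to.
  by move=> e e0; exact: (gromov_cauchy_visual (sequences_to_gromov_cauchy sx sx) e0).
move=> [y _ yx]; have : completion_embed E o a y (fun=> y).
  split; last by apply: cvg_near_cst; apply: nearW => n; rewrite visxx.
  by move=> e e0; exists 0%N => m n _ _; rewrite visxx.
rewrite yx => -[/(_ (level y).+1)[M _ /(_ M (leqnn M))] /=].
by rewrite ltnn.
Qed.

End Visual.

Section BoundaryProduct.
Hypothesis K_le : forall x, K x -> `|x| <= b.
Hypothesis limit_of_centers : forall x, K x -> exists s, sequences_to x s.
Local Notation gpb x y := (gromov_product_boundary R E o (sequences_to x) (sequences_to y)).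

(** Bounds from below need only one pair of representing sequences, since the
product of boundary points is a supremum over all of them. *)
Lemma gromov_product_boundary_ge x y s t r M : sequences_to x s -> sequences_to y t ->
  (forall m n, (M <= m)%N -> (M <= n)%N -> r <= gp (s m) (t n)) -> (r%:E <= gpb x y)%E.
Proof.
move=> sx ty rst; apply: (@le_trans _ _ (gromov_liminf R E o s t)).
  apply: le_trans (ereal_sup_ubound _); last by exists M.
  by apply: le_ereal_inf_tmp => _ [[m n] /= [Mm Mn] <-]; rewrite lee_fin rst.
by apply: ereal_sup_ubound; exists (s, t).
Qed.

Lemma gromov_product_boundary_ge0 x y : K x -> K y -> (0 <= gpb x y)%E.
Proof.
move=> /limit_of_centers[s sx] /limit_of_centers[t ty].
by apply: (gromov_product_boundary_ge (M := 0%N) sx ty) => m n _ _.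
Qed.

Lemma close_gromov_product_boundary c : 0 <= c -> exists m : nat, forall x y k,
  K x -> K y -> `|B ^+ k *m (x - y)| <= c -> ((k%:R - m%:R)%:E <= gpb x y)%E.
Proof.
move=> c0; have [m Hm] := close_gp (addr_ge0 c0 ler01).
exists m => x y k /limit_of_centers[s sx] /limit_of_centers[t ty] kxy.
have [M1 HM1] := dilated_limit k sx ty ltr01.
have [M2 _ HM2] := sx.1 k; have [M3 _ HM3] := ty.1 k.
apply: (gromov_product_boundary_ge (M := maxn M1 (maxn M2 M3)) sx ty) => i j.
rewrite !geq_max => /and3P[i1 i2 i3] /and3P[j1 j2 j3].
apply: Hm; [exact: HM2|exact: HM3|].
rewrite -[X in `|X|](subrK (B ^+ k *m (x - y))) (le_trans (ler_normD _ _)) //.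
by rewrite addrC lerD // HM1.
Qed.

(** The bound [W] of [gp_close] survives in the limit, whichever sequences
represent the two points. *)
Lemma gromov_product_boundary_close x y k :
  (k%:R%:E < gpb x y)%E -> `|B ^+ k *m (x - y)| <= W.
Proof.
move=> /ereal_sup_gt[_ [[s t] [/= sx ty] <-]] /ereal_sup_gt[_ [M _ <-]] kM.
apply/ler_addgt0Pl => e e0.
have [M1 HM1] := dilated_limit k sx ty e0.
pose n := maxn M M1.
have kst : k%:R <= gp (s n) (t n).
  rewrite -lee_fin (le_trans (ltW kM)) //; apply: ereal_inf_lbound.
  by exists (n, n) => //=; rewrite leq_maxl.
have [_ _ kW] := gp_close kst.
have := HM1 n n (leq_maxr _ _) (leq_maxr _ _).
rewrite distrC => h; rewrite -[X in `|X|](subrK (B ^+ k *m (center (s n) - center (t n)))).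
by rewrite (le_trans (ler_normD _ _)) // lerD.
Qed.

Lemma expansion_int_le (k : int) n (v : 'cV[R]_d.+1) :
  `|B ^ k *m v| <= C * rho ^+ n * `|B ^ (k + n%:Z) *m v|.
Proof.
have [uB _ _ Bx] := expB; rewrite (le_trans (Bx n _)) // mulmxA.
by rewrite [k + _]addrC exprzDr.
Qed.

(** If the product were much larger than [k], then [x - y] would be bounded after a
dilation of exponent much larger than [k], by [gromov_product_boundary_close], and
hence shorter than 1 at the exponent [k].  Conversely the bound [c] at the exponent
[k] gives the lower estimate.  The exponent may be negative, but not by much, as [K]
is bounded. *)
Lemma gromov_product_boundary_scale c : 0 <= c -> exists m : nat, forall x y (k : int),
  K x -> K y -> 1 < `|B ^ k *m (x - y)| <= c ->
  `|fine (gpb x y) - k%:~R| <= m%:R.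
Proof.
move=> c0; have [m1 Hm1] := close_gromov_product_boundary c0.
have [m2 Hm2] := geometric_small (C * (`|W| + (`|b| + `|b|)))
  (introT andP (conj rho0 rho1)) ltr01.
exists (m1 + m2)%N => x y k Kx Ky /andP[k1 kc].
have small n r : (m2 <= n)%N -> r <= `|W| + (`|b| + `|b|) ->
    1 < C * rho ^+ n * r -> False.
  move=> /Hm2 h hr; apply/negP; rewrite -leNgt; apply: le_trans (ltW h).
  by rewrite [leRHS]mulrAC ler_wpM2l // mulr_ge0 ?(ltW C0) // exprn_ge0 // ltW.
have upper j : (j%:R%:E < gpb x y)%E -> (j%:Z < k + m2%:Z).
  move=> /gromov_product_boundary_close jW; rewrite ltNge; apply/negP => kj.
  have [n nE] : exists n : nat, j%:Z = k + n%:Z by exists `|j%:Z - k|%N; lia.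
  apply: (small n (`|B ^+ j *m (x - y)|)); first by lia.
    by rewrite (le_trans jW) // (le_trans (ler_norm W)) // lerDl addr_ge0.
  by apply: (lt_le_trans k1); have := expansion_int_le k n (x - y); rewrite -nE.
(* the difference of two points of [K] is already bounded at scale 0 *)
have k_ge : 0 < k + m2%:Z.
  rewrite ltNge; apply/negP => km.
  have [n nE] : exists n : nat, 0 = k + n%:Z by exists `|k|%N; lia.
  apply: (small n (`|x - y|)); first by lia.
    rewrite (le_trans (ler_normB _ _)) // -[leLHS]add0r lerD // lerD //.
      by rewrite (le_trans (K_le Kx)) // ler_norm.
    by rewrite (le_trans (K_le Ky)) // ler_norm.
  apply: (lt_le_trans k1); have := expansion_int_le k n (x - y).
  by rewrite -nE expr0z mul1mx.
have g0 := gromov_product_boundary_ge0 Kx Ky.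
(* if the product exceeded [k + m2], this integer would contradict [upper] *)
have [n nE] : exists n : nat, k + m2%:Z = n%:Z by exists (absz (k + m2%:Z)); lia.
have gn : (gpb x y <= n%:R%:E)%E.
  by rewrite leNgt; apply/negP => /upper; rewrite nE ltxx.
have gfin : gpb x y \is a fin_num.
  by rewrite fin_numElt (lt_le_trans _ g0) ?ltNy0 // (le_lt_trans gn) ?ltry.
have kn : k%:~R + m2%:R = n%:R :> R.
  by have := congr1 (fun z : int => z%:~R : R) nE; rewrite rmorphD /=.
have gk : fine (gpb x y) <= k%:~R + m2%:R by rewrite kn -lee_fin fineK.
have g0' : 0 <= fine (gpb x y) by apply: fine_ge0.
have m10 : 0 <= m1%:R :> R by [].
have m20 : 0 <= m2%:R :> R by [].
have kg : k%:~R - m1%:R <= fine (gpb x y).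
  case: k k1 kc {upper k_ge nE kn gk} => j j1 jc.
    by rewrite -lee_fin fineK //; apply: Hm1.
  have : (Negz j)%:~R <= 0 :> R by rewrite lerz0.
  by lra.
by rewrite natrD ler_norml; lra.
Qed.

End BoundaryProduct.

End Boundary.

(** * Iterated integrals of nonnegative functions *)

Section IteratedIntegral.
Variable R : realType.
Implicit Type d : nat.

(** The integral of a nonnegative function is a supremum over simple functions
below it, so it is monotone even for functions that are not measurable.  Together
with the volume of a box this is all that the estimates of the convolution need. *)
Lemma le_integral_ge0 (f g : R -> \bar R) :
  (forall x, 0 <= f x)%E -> (forall x, f x <= g x)%E ->
  (\int[lebesgue_measure]_(x in [set: R]) f x <= \int[lebesgue_measure]_(x in [set: R]) g x)%E.
Proof.
move=> f0 fg; have g0 x : (0 <= g x)%E by exact: le_trans (f0 x) (fg x).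
rewrite !ge0_integralE // !patch_setT.
apply: le_ereal_sup => _ [h hf <-]; exists h => // x; exact: le_trans (hf x) (fg x).
Qed.

Lemma integral_cV_ge0 d (f : 'cV[R]_d -> \bar R) :
  (forall x, 0 <= f x)%E -> (0 <= integral_cV f)%E.
Proof.
elim: d f => [|d IH] f f0 /=; first exact: f0.
by apply: integral_ge0 => t _; apply: IH.
Qed.

Lemma integral_cV_le d (f g : 'cV[R]_d -> \bar R) :
  (forall x, 0 <= f x)%E -> (forall x, f x <= g x)%E ->
  (integral_cV f <= integral_cV g)%E.
Proof.
elim: d f g => [|d IH] f g f0 fg /=; first exact: fg.
apply: le_integral_ge0 => t; first exact: integral_cV_ge0.
by apply: IH.
Qed.

Lemma integral_cV_ext d (f g : 'cV[R]_d -> \bar R) :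
  f =1 g -> integral_cV f = integral_cV g.
Proof. by move=> /funext ->. Qed.

Definition in_box d (z : 'cV[R]_d) (r : R) (y : 'cV[R]_d) : bool :=
  [forall i, `|y i ord0 - z i ord0| <= r].

Lemma integral_interval (z r c : R) : 0 <= r ->
  (\int[lebesgue_measure]_(t in [set: R]) ((`|t - z| <= r)%R%:R * c)%R%:E = (2 * r * c)%R%:E)%E.
Proof.
move=> r0; pose I : set R := `[z - r, z + r]%classic.
transitivity (\int[lebesgue_measure]_(t in I) (cst c%:E) t)%E.
  rewrite [RHS]integral_mkcond; apply: eq_integral => t _.
  rewrite patchE /= /I.
  have -> : (t \in `[z - r, z + r]%classic) = (`|t - z| <= r).
    by rewrite mem_setE in_itv /= ler_distl.
  by case: ifP; rewrite ?mul1r ?mul0r.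
rewrite integral_cst; last exact: measurable_itv.
transitivity (c%:E * (2 * r)%:E)%E; last by rewrite -EFinM mulrC.
congr (_ * _)%E; apply: (etrans (lebesgue_measure_itv `[z - r, z + r])) => /=.
rewrite lte_fin; case: ifP => [_|/negbT]; first by rewrite -EFinB; congr EFin; lra.
by rewrite -leNgt => zr; congr EFin; lra.
Qed.

Lemma in_box_col_mx d (z : 'cV[R]_(1 + d)) r t y :
  in_box z r (col_mx (const_mx t : 'cV[R]_1) y) =
  (`|t - z ord0 ord0| <= r) && in_box (dsubmx z) r y.
Proof.
have z0 : ord0 = lshift d ord0 :> 'I_(1 + d) by exact: val_inj.
apply/forallP/andP => [h|[tr /forallP yr] i].
  split; first by have := h (lshift d ord0); rewrite col_mxEu mxE z0.
  by apply/forallP => i; have := h (rshift 1 i); rewrite col_mxEd mxE.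
have [j ->|j ->] := split_ordP i; last by have := yr j; rewrite col_mxEd mxE.
by rewrite col_mxEu mxE (ord1 j) -z0.
Qed.

Lemma integral_cV_box d (z : 'cV[R]_d) (r c : R) : 0 <= r ->
  integral_cV (fun y => ((in_box z r y)%:R * c)%:E) = ((2 * r) ^+ d * c)%:E.
Proof.
move=> r0; elim: d z c => [|d IH] z c /=.
  congr (_%:E); rewrite expr0 /in_box.
  by have -> : [forall i, `|(0 : 'cV[R]_0) i ord0 - z i ord0| <= r] by apply/forallP => -[].
transitivity (\int[lebesgue_measure]_(t in [set: R])
    ((`|t - z ord0 ord0| <= r)%R%:R * ((2 * r) ^+ d * c))%R%:E)%E.
  apply: eq_integral => t _.
  rewrite mulrCA -(IH (dsubmx (z : 'cV[R]_(1 + d)))).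
  apply: integral_cV_ext => y; congr EFin.
  by rewrite mulrA -natrM mulnb andbC -in_box_col_mx.
rewrite integral_interval // exprS; congr EFin; ring.
Qed.

End IteratedIntegral.

(** * The smoothed indicator of the shell *)

Section ShellConvolution.
Variables (R : realType) (d : nat) (A : 'M[int]_d.+1).
Variables (phi : 'cV[R]_d.+1 -> R) (eps0 : R).
Local Notation B := (real_mx R A).
Local Notation h := (shell_convolution A phi).
Hypothesis uB : B \in unitmx.
Hypothesis eps0_lt : eps0 < 1 / 2.
Hypothesis phi_cts : continuous phi.
Hypothesis phi_ge0 : forall x, 0 <= phi x.
Hypothesis phi_supp : forall x, phi x != 0 -> euclidean_ball eps0 x.

(** Working with squares keeps the square root of the Euclidean norm out of the
estimates. *)
Definition sum_sqr (x : 'cV[R]_d.+1) : R := \sum_(i < d.+1) x i 0 ^+ 2.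

Lemma sum_sqr_ge0 x : 0 <= sum_sqr x.
Proof. by rewrite sumr_ge0 // => i _; rewrite sqr_ge0. Qed.

Lemma euclidean_ballE r x : 0 < r -> euclidean_ball r x <-> sum_sqr x < r ^+ 2.
Proof.
move=> r0; rewrite /euclidean_ball /= /euclidean_norm -/(sum_sqr x).
by rewrite -{1}(ger0_norm (ltW r0)) -sqrtr_sqr ltr_sqrt // exprn_gt0.
Qed.

Lemma sum_sqrZ t x : sum_sqr (t *: x) = t ^+ 2 * sum_sqr x.
Proof. by rewrite mulr_sumr; apply: eq_bigr => i _; rewrite mxE exprMn. Qed.

Lemma sum_sqr_le x : sum_sqr x <= d.+1%:R * `|x| ^+ 2.
Proof.
rewrite -[X in X%:R]card_ord mulr_natl -sumr_const; apply: ler_sum => i _.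
by rewrite -real_normK ?num_real // lerXn2r ?nnegrE // norm_entry_le.
Qed.

Lemma norm_le_sum_sqr x : `|x| ^+ 2 <= sum_sqr x.
Proof.
rewrite -[leRHS]sqr_sqrtr ?sum_sqr_ge0 // lerXn2r ?nnegrE ?sqrtr_ge0 //.
apply: norm_le_entries => [|i j]; first exact: sqrtr_ge0.
rewrite -sqrtr_sqr ler_wsqrtr // /sum_sqr (bigD1 i) //= (ord1 j) lerDl.
by rewrite sumr_ge0 // => k _; rewrite sqr_ge0.
Qed.

(** This replaces the triangle inequality: the constant 2 is affordable because
the support of [phi] has radius less than [1 / 2]. *)
Lemma sum_sqrD x y : sum_sqr (x + y) <= 2 * sum_sqr x + 2 * sum_sqr y.
Proof.
rewrite !mulr_sumr -big_split /=; apply: ler_sum => i _; rewrite mxE.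
have := sqr_ge0 (x i 0 - y i 0); rewrite sqrrB sqrrD; lra.
Qed.

Lemma sum_sqr_cts : continuous sum_sqr.
Proof.
apply: continuous_big => [|i _]; first exact: add_continuous.
move=> x; apply: (@continuous_comp _ _ _ (fun y : 'cV[R]_d.+1 => y i 0) (fun t : R => t ^+ 2)).
  exact: coord_continuous.
exact: exprn_continuous.
Qed.

Lemma shellE y : shell A y <-> sum_sqr (invmx B *m y) < 1 /\ 1 <= sum_sqr y.
Proof.
have b1 x : euclidean_ball 1 x <-> sum_sqr x < 1.
  by rewrite euclidean_ballE // expr1n.
rewrite /shell; split.
  move=> [[x /b1 x1 <-] /b1/negP]; rewrite -leNgt mulmxA mulVmx // mul1mx //.
move=> [y1 y2]; split; last by apply/b1/negP; rewrite -leNgt.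
by exists (invmx B *m y); [exact/b1|rewrite mulmxA mulmxV // mul1mx].
Qed.

Lemma norm_shell y : shell A y -> `|y| <= d.+1%:R * `|B|.
Proof.
move=> /shellE[y1 _]; rewrite -[y]mul1mx -(mulmxV uB) -mulmxA.
rewrite (le_trans (norm_mulmx_le _ _)) // ler_piMr ?mulr_ge0 //.
have := le_lt_trans (norm_le_sum_sqr (invmx B *m y)) y1.
by rewrite expr_lt1 // => /ltW.
Qed.

Lemma phi_support x : phi x != 0 -> sum_sqr x < 4^-1.
Proof.
move=> /phi_supp; rewrite /euclidean_ball /= /euclidean_norm -/(sum_sqr x) => xe.
have e0 : 0 < eps0 by apply: le_lt_trans xe; exact: sqrtr_ge0.
have := lt_trans xe eps0_lt; rewrite -(@ltr_pXn2r _ 2) ?nnegrE ?sqrtr_ge0 ?divr_ge0 //.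
by rewrite sqr_sqrtr ?sum_sqr_ge0 // => /lt_le_trans; apply; lra.
Qed.

Lemma phi_bounded : exists M, 0 <= M /\ forall x, phi x <= M.
Proof.
have S1 : compact [set x : 'cV[R]_d.+1 | `|x| <= 1].
  apply: cV_compact.
    by exists 1; split=> // M M1 x /= x1; rewrite (le_trans x1) // ltW.
  apply: (@preimage_closed _ _ (fun x : 'cV[R]_d.+1 => `|x|) [set y | y <= 1]).
    by move=> x _; exact: norm_continuous.
  exact: closed_le.
have := compact_bounded (continuous_compact (continuous_subspaceT phi_cts) S1).
move=> [M [_ HM]]; exists (`|M| + 1); split=> [|x]; first by rewrite addr_ge0.
have [->|/phi_support x1] := eqVneq (phi x) 0; first by rewrite addr_ge0.
rewrite (le_trans (ler_norm _)) // (HM (`|M| + 1)) //.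
  by rewrite (le_lt_trans (ler_norm _)) // ltrDl.
exists x => //=.
have := le_lt_trans (norm_le_sum_sqr x) x1 => /ltW h.
by rewrite -(@expr_le1 _ 2) //; lra.
Qed.

Let integrand x y : R := \1_(shell A) y * phi (x - y).

Let integrand_ge0 x y : (0 <= (integrand x y)%:E)%E.
Proof. by rewrite lee_fin mulr_ge0. Qed.

Lemma shell_convolution_bounded : exists H, 0 <= H /\ forall x,
  [/\ integral_cV (fun y => (integrand x y)%:E) \is a fin_num, 0 <= h x & h x <= H].
Proof.
have [M [M0 phiM]] := phi_bounded.
pose r := d.+1%:R * `|B|; have r0 : 0 <= r by rewrite mulr_ge0.
exists ((2 * r) ^+ d.+1 * M); split; first by rewrite mulr_ge0 // exprn_ge0 // mulr_ge0.
move=> x; set I := integral_cV _.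
have I0 : (0 <= I)%E by apply: integral_cV_ge0.
have IM : (I <= ((2 * r) ^+ d.+1 * M)%:E)%E.
  rewrite -(integral_cV_box (0 : 'cV[R]_d.+1)) //; apply: integral_cV_le => // y.
  rewrite lee_fin /integrand indicE; case: (boolP (y \in shell A)) => [|_]; last first.
    by rewrite mul0r mulr_ge0.
  rewrite inE => /norm_shell yr; rewrite mul1r.
  suff -> : in_box 0 r y by rewrite mul1r.
  by apply/forallP => i; rewrite mxE subr0 (le_trans (norm_entry_le _ _ _)).
have Ifin : I \is a fin_num.
  by rewrite fin_numElt (lt_le_trans _ I0) ?ltNy0 // (le_lt_trans IM) ?ltry.
by split=> //; [exact: fine_ge0|rewrite -lee_fin fineK].
Qed.

Lemma shell_convolution_neq0 x : h x != 0 -> exists2 y, shell A y & phi (x - y) != 0.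
Proof.
apply: contra_neqP => /forall2NP hn.
rewrite /shell_convolution (@integral_cV_ext _ _ _ (fun y => ((in_box 0 0 y)%:R * 0)%:E)).
  by rewrite integral_cV_box // mulr0.
move=> y; congr EFin; rewrite mulr0 indicE.
have [yS|/negP] := hn y; first by rewrite memNset // mul0r.
by rewrite negbK => /eqP ->; rewrite mulr0.
Qed.

(** If the shell has a point [y] with [x - y] in the support of [phi], then
[1 <= sum_sqr y <= 2 * sum_sqr x + 2 * sum_sqr (x - y)] and the last term is less
than [1 / 2], so [x] is bounded away from 0. *)
Lemma shell_convolution_support : exists r1 r2, [/\ 0 < r1, 0 < r2 &
  forall x, h x != 0 -> r1 <= `|x| <= r2].
Proof.
exists (2 * d.+1%:R)^-1, (d.+1%:R * `|B| + 1); split.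
- by rewrite invr_gt0 mulr_gt0.
- by rewrite ltr_wpDl // mulr_ge0.
move=> x /shell_convolution_neq0[y Sy /phi_support xy]; apply/andP; split.
  have [_ y1] := (shellE y).1 Sy.
  have := sum_sqrD x (- (x - y)); rewrite opprB addrC subrK => h2.
  have nxy : sum_sqr (y - x) = sum_sqr (x - y).
    by rewrite -opprB -scaleN1r sum_sqrZ sqrrN expr1n mul1r.
  have x4 : 4^-1 < sum_sqr x by move: h2; rewrite nxy; lra.
  have := lt_le_trans x4 (sum_sqr_le x) => x5.
  rewrite leNgt; apply/negP => xlt.
  set u := (2 * d.+1%:R)^-1 in xlt.
  have uD : d.+1%:R * u = 2^-1 by rewrite /u invfM mulrCA mulfV ?mulr1.
  have u0 : 0 <= u by rewrite invr_ge0 mulr_ge0.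
  have u2 : u <= d.+1%:R * u by rewrite ler_peMl // ler1n.
  have : d.+1%:R * `|x| ^+ 2 <= d.+1%:R * u ^+ 2.
    by rewrite ler_wpM2l // lerXn2r ?nnegrE // ltW.
  by move: x5; rewrite [u ^+ 2]expr2 [_ * (u * u)]mulrA uD; lra.
have -> : x = y + (x - y) by rewrite addrC subrK.
rewrite (le_trans (ler_normD _ _)) // lerD ?norm_shell //.
have := le_lt_trans (norm_le_sum_sqr (x - y)) xy => /ltW h2.
by rewrite -(@expr_le1 _ 2) //; lra.
Qed.

(** Lower semicontinuity.  A point [y0] of the shell with [phi (x0 - y0)] positive
may lie on the unit sphere, which belongs to the shell; pushing it slightly
outwards gives a point [y1] in the interior of the shell with [phi (x0 - y1)] still
positive.  Then the integrand is bounded below on a box around [y1], for all [x]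
near [x0]. *)
Lemma shell_convolution_lower x0 : h x0 != 0 ->
  exists2 c, 0 < c & \forall x \near x0, c <= h x.
Proof.
move=> /shell_convolution_neq0[y0 /shellE[y0_in y0_out] phi0].
have phi_gt : 0 < phi (x0 - y0) by rewrite lt_neqAle eq_sym phi0 phi_ge0.
have cB : continuous (fun y : 'cV[R]_d.+1 => sum_sqr (invmx B *m y)).
  by move=> y; apply: continuous_comp; [exact: mulmx_continuous|exact: sum_sqr_cts].
have cphi : {for y0, continuous (fun y : 'cV[R]_d.+1 => phi (x0 - y))}.
  apply: (@continuous_comp _ _ _ (fun y : 'cV[R]_d.+1 => x0 - y) phi); last exact: phi_cts.
  apply: (@lipschitz_cts _ _ _ _ 1) => // y z; rewrite mul1r distrC.
  by rewrite opprB addrC addrA subrK.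
have near1 : \forall y \near y0, sum_sqr (invmx B *m y) < 1 /\ 0 < phi (x0 - y).
  near=> y; split; near: y.
    exact: (cvgr_lt _ (cB y0)).
  exact: (cvgr_gt _ cphi).
move: near1 => /nbhs_normP[e /= e0 He].
pose t := e / 2 / (`|y0| + 1).
have t0 : 0 < t by rewrite !divr_gt0 // ltr_wpDl.
pose y1 := (1 + t) *: y0.
have [y1_in phi1] : sum_sqr (invmx B *m y1) < 1 /\ 0 < phi (x0 - y1).
  apply: He; rewrite /= /y1 scalerDl scale1r opprD addNKr normrN normrZ gtr0_norm //.
  have : t * `|y0| <= t * (`|y0| + 1) by rewrite ler_wpM2l ?(ltW t0) // lerDl.
  by rewrite {2}/t divfK ?gt_eqF ?ltr_wpDl //; lra.
have y1_out : 1 < sum_sqr y1.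
  rewrite sum_sqrZ (lt_le_trans (_ : 1 < (1 + t) ^+ 2)) // ?exprn_egt1 ?ltrDl // ler_peMr //.
  by rewrite exprn_ge0 // addr_ge0 // ltW.
pose c := phi (x0 - y1) / 2; have c0 : 0 < c by rewrite divr_gt0.
have near2 : \forall y \near y1, sum_sqr (invmx B *m y) < 1 /\ 1 < sum_sqr y.
  near=> y; split; near: y; first exact: (cvgr_lt _ (cB y1)).
  by apply: (cvgr_gt (sum_sqr y1)) => //; exact: sum_sqr_cts.
move: near2 => /nbhs_normP[e1 /= e1_0 He1].
pose z1 : 'cV[R]_d.+1 := x0 - y1.
have near3 : \forall z \near z1, c < phi z.
  near=> z; near: z; apply: (cvgr_gt (phi z1)); first exact: phi_cts.
  by rewrite /c -/z1; move: phi1; rewrite -/z1; lra.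
move: near3 => /nbhs_normP[e2 /= e2_0 He2].
pose r := Num.min e1 (e2 / 2) / 2.
have r0 : 0 < r by rewrite divr_gt0 // lt_min e1_0 divr_gt0.
have min1 : Num.min e1 (e2 / 2) <= e1 by rewrite ge_min lexx.
have min2 : Num.min e1 (e2 / 2) <= e2 / 2 by rewrite ge_min lexx orbT.
have re1 : r < e1 by rewrite /r; lra.
have re2 : 2 * r < e2 by rewrite /r; lra.
exists ((2 * r) ^+ d.+1 * c); first by rewrite mulr_gt0 // exprn_gt0 // mulr_gt0.
apply/nbhs_normP; exists r => // x /= x0x.
have [_ [_ /(_ x)[Ifin _ _]]] := shell_convolution_bounded.
rewrite -lee_fin fineK // -(integral_cV_box y1) ?(ltW r0) //.
apply: integral_cV_le => y; first by rewrite lee_fin mulr_ge0 // ltW.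
rewrite lee_fin; case: (boolP (in_box y1 r y)) => [/forallP yr|_]; last first.
  by rewrite mul0r -lee_fin integrand_ge0.
have yy : `|y1 - y| <= r.
  apply: norm_le_entries => [|i j]; first exact: ltW.
  by rewrite mxE [(- y) i j]mxE distrC (ord1 j); exact: yr.
have [y_in y_out] := He1 y (le_lt_trans yy re1).
rewrite /integrand indicE mem_set; last by apply/shellE; split=> //; exact: ltW.
rewrite !mul1r ltW //; apply: He2 => /=.
have -> : x0 - y1 - (x - y) = (x0 - x) - (y1 - y) by apply/matrixP => i j; rewrite !mxE; ring.
rewrite (le_lt_trans (ler_normB _ _)) // (lt_le_trans _ (ltW re2)) //.
by rewrite mulr2n mulrDl mul1r ltr_leD.
Unshelve. all: by end_near.
Qed.

End ShellConvolution.

(** * The size of a pseudo-norm *)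

Lemma add_distz (k n : int) : k <= n -> k + (absz (n - k))%:Z = n.
Proof. by lia. Qed.

Lemma mem_int_window (k n : int) m : (absz (n - k)%R < m)%N ->
  n \in [seq k - m%:Z + i%:Z | i <- iota 0 (2 * m).+1].
Proof.
move=> nk; apply/mapP; exists (absz (n - (k - m%:Z))%R); last by lia.
by rewrite mem_iota; lia.
Qed.

Section PseudoNormScale.
Variables (R : realType) (d q : nat) (A : 'M[int]_d.+1) (C rho : R).
Variable (w : 'cV[R]_d.+1 -> R).
Local Notation B := (real_mx R A).
Hypothesis expB : expands_with B C rho.
Hypothesis q_gt0 : (0 < q)%N.
Hypothesis w_pseudo_norm : pseudo_norm A q w.

Let C0 : 0 < C. Proof. by case: expB. Qed.
Let rho0 : 0 < rho. Proof. by case: expB => _ _ /andP[]. Qed.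
Let rho1 : rho < 1. Proof. by case: expB => _ _ /andP[]. Qed.

(** The [t]-th power of [q ^ (1 / d)], the factor by which the dilation by [B]
multiplies a pseudo-norm. *)
Definition scale_power (t : R) : R := q%:R `^ (t / d.+1%:R).

Lemma scale_power_gt0 t : 0 < scale_power t.
Proof. by rewrite powR_gt0 // ltr0n. Qed.

Lemma scale_powerD s t : scale_power (s + t) = scale_power s * scale_power t.
Proof.
by rewrite /scale_power mulrDl powRD //; apply/implyP => _; rewrite pnatr_eq0 -lt0n.
Qed.

Lemma scale_power_le s t : s <= t -> scale_power s <= scale_power t.
Proof.
by move=> st; rewrite /scale_power ler_powR ?ler1n // ler_wpM2r // invr_ge0.
Qed.

(** Only the indices [n] with [|n - k| < m] contribute, for a uniform [m], and the
convolution is bounded: this is the upper bound.  For the lower bound, definiteness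
makes some summand nonzero at every point of the annulus [1 <= |y| <= c]; by lower
semicontinuity it is bounded below nearby, and by compactness the bound and the
index can be chosen uniformly. *)
Lemma pseudo_norm_scale c : exists c1 c2 : R, [/\ 0 < c1, 0 < c2 &
  forall v (k : int), 1 < `|B ^ k *m v| <= c ->
    c1 * scale_power (- k%:~R) <= w v <= c2 * scale_power (- k%:~R)].
Proof.
have [uB _ _ _] := expB.
have [[eps0 [phi [/andP[_ eps0_lt] /(_ 0%N)[phi_cts _] [phi_ge0 _] [phi_supp _] wE]]] w0] :=
  w_pseudo_norm.
pose h := shell_convolution A phi.
have [H [H0 hH]] := shell_convolution_bounded uB eps0_lt phi_cts phi_ge0 phi_supp.
have h0 x : 0 <= h x by have [] := hH x.
have {}hH x : h x <= H by have [] := hH x.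
have [r1 [r2 [r1_0 r2_0 hr]]] := shell_convolution_support uB eps0_lt phi_supp.
pose T v (n : int) : R := q%:R `^ (- n%:~R / d.+1%:R) * h (B ^ n *m v).
have TE v n : T v n = scale_power (- n%:~R) * h (B ^ n *m v) by [].
have T0 v n : 0 <= T v n by rewrite mulr_ge0 // powR_ge0.
have {}wE v : w v = fine (\esum_(n in [set: int]) (T v n)%:E)%E by rewrite wE.
have c_gt (v : 'cV[R]_d.+1) (k : int) : 1 < `|B ^ k *m v| <= c -> 0 < c.
  by move=> /andP[k1 kc]; apply: lt_le_trans kc; exact: lt_trans ltr01 k1.
have [m Hm] : exists m : nat, forall v (k n : int), 1 < `|B ^ k *m v| <= c ->
    h (B ^ n *m v) != 0 -> (`|n - k| < m)%N.
  have [m Hm] := geometric_small (C * (r2 + `|c| / r1)) (introT andP (conj rho0 rho1)) ltr01.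
  exists m => v k n vk; have c_0 := c_gt _ _ vk; move: vk => /andP[k1 kc] /hr /andP[n1 n2].
  have rn0 j : 0 <= C * rho ^+ j by rewrite mulr_ge0 ?(ltW C0) // exprn_ge0 // ltW.
  have cr0 : 0 <= `|c| / r1 by rewrite divr_ge0 // ltW.
  rewrite ltnNge; apply/negP => /Hm; apply/negP; rewrite -leNgt mulrAC mulrDr.
  have [kn|nk] := leP k n.
    have kE : k + (absz (n - k))%:Z = n by exact: add_distz.
    have := expansion_int_le expB k (absz (n - k)) v; rewrite kE.
    move=> /(lt_le_trans k1) /ltW h1; rewrite (le_trans h1) //.
    apply: (@le_trans _ _ (C * rho ^+ `|n - k|%N * r2)); first by rewrite ler_wpM2l.
    by rewrite lerDl mulr_ge0.
  have nE : n + (absz (n - k))%:Z = k by rewrite distnC add_distz // ltW.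
  have := expansion_int_le expB n (absz (n - k)) v; rewrite nE.
  move=> /(le_trans n1) h1.
  apply: (@le_trans _ _ (C * rho ^+ `|n - k|%N * (`|c| / r1))); last first.
    by rewrite lerDr mulr_ge0 // ltW.
  rewrite mulrA ler_pdivlMr // mul1r (le_trans h1) // ler_wpM2l //.
  by rewrite (le_trans kc) // ler_norm.
have esum_le v k : 1 < `|B ^ k *m v| <= c ->
    (\esum_(n in [set: int]) (T v n)%:E
      <= ((2 * m).+1%:R * (scale_power m%:R * H) * scale_power (- k%:~R))%:E)%E.
  move=> vk.
  pose s : seq int := [seq k - m%:Z + i%:Z | i <- iota 0 (2 * m).+1].
  have us : uniq s.
    by rewrite map_inj_uniq ?iota_uniq // => i j /addrI [].
  have -> : \esum_(n in [set: int]) (T v n)%:E = \esum_(n in [set` s]) (T v n)%:E.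
    rewrite [RHS]esum_mkcond; apply: eq_esum => n _.
    case: ifPn => // ns; congr EFin; rewrite /T.
    have [->|/(Hm _ _ _ vk) nk] := eqVneq (h (B ^ n *m v)) 0; first by rewrite mulr0.
    by case/negP: ns; rewrite mem_setE; exact: mem_int_window.
  rewrite esum_fset; [|exact: finite_seq|by move=> n _; rewrite lee_fin].
  rewrite -fsbig_seq //.
  rewrite sumEFin lee_fin.
  apply: (@le_trans _ _ (\sum_(n <- s) (scale_power m%:R * H * scale_power (- k%:~R)))).
    rewrite big_seq [leRHS]big_seq; apply: ler_sum => n /mapP[i _ ->].
    rewrite TE mulrAC ler_pM ?powR_ge0 // -scale_powerD; apply: scale_power_le.
    rewrite !intrD mulrNz; have : 0 <= i%:R :> R by [].
    by rewrite -[i%:~R]/(i%:R : R) -[m%:~R]/(m%:R : R); lra.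
  rewrite big_const_seq count_predT size_map size_iota iter_addr_0.
  by rewrite -[leLHS]mulr_natl !mulrA.
have esum_fin v k : 1 < `|B ^ k *m v| <= c -> (\esum_(n in [set: int]) (T v n)%:E)%E \is a fin_num.
  move=> vk; have E0 : (0 <= \esum_(n in [set: int]) (T v n)%:E)%E.
    by apply: esum_ge0 => n _; rewrite lee_fin.
  by rewrite fin_numElt (lt_le_trans _ E0) ?ltNy0 // (le_lt_trans (esum_le _ _ vk)) ?ltry.
have T_le v k n : 1 < `|B ^ k *m v| <= c -> T v n <= w v.
  move=> vk; rewrite wE -lee_fin fineK ?(esum_fin _ _ vk) //.
  apply: esum_ge; exists [set n]; first by split.
  by rewrite fsbig_set1.
have [m' Hm'] : exists m' : nat, forall y, 1 <= `|y| <= c ->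
    exists n : int, (`|n| <= m')%N /\ m'.+1%:R^-1 <= h (B ^ n *m y).
  pose P (i : nat) (y : 'cV[R]_d.+1) :=
    exists n : int, (`|n| <= i)%N /\ i.+1%:R^-1 <= h (B ^ n *m y).
  have cpt : compact [set y : 'cV[R]_d.+1 | 1 <= `|y| <= c].
    apply: cV_compact.
      exists c; split=> [|M M1 x /= /andP[_ xc]]; first exact: num_real.
      by rewrite (le_trans xc) // ltW.
    rewrite (_ : mkset _ = [set y | 1 <= `|y|] `&` [set y | `|y| <= c]); last first.
      by apply/seteqP; split=> y /= /andP.
    apply: closedI.
      apply: (@preimage_closed _ _ (fun x : 'cV[R]_d.+1 => `|x|) [set y | 1 <= y]).
        by move=> x _; exact: norm_continuous.
      exact: closed_ge.
    apply: (@preimage_closed _ _ (fun x : 'cV[R]_d.+1 => `|x|) [set y | y <= c]).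
      by move=> x _; exact: norm_continuous.
    exact: closed_le.
  have := (compact_near_coveringP _).1 cpt nat \oo P _.
  case=> [|m0 _ Hm0].
  - move=> y /andP[y1 _].
    have y0 : y <> 0 by move=> y0; move: y1; rewrite y0 normr0 ler10.
    have [n hn] : exists n : int, h (B ^ n *m y) != 0.
      apply/not_existsP => hn; apply: y0; apply/w0.
      rewrite wE esum1 // => n _; rewrite /T; congr EFin.
      by have /negP := hn n; rewrite negbK => /eqP ->; rewrite mulr0.
    have [e e0 He] := shell_convolution_lower uB eps0_lt phi_cts phi_ge0 phi_supp hn.
    have near_y : \forall z \near y, e <= h (B ^ n *m z).
      exact: (@mulmx_continuous R d.+1 d.+1 1 (B ^ n) y _ He).
    exists ([set z | e <= h (B ^ n *m z)],
            [set i | maxn `|n|%N (Num.truncn e^-1) <= i]%N).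
      by split=> //=; exists (maxn `|n|%N (Num.truncn e^-1)).
    move=> [z i] /= [ez]; rewrite geq_max => /andP[ni ei].
    exists n; split=> //; apply: le_trans ez.
    rewrite invf_ple ?posrE ?ltr0n // (le_trans (ltW (truncnS_gt _))) //.
    by rewrite ler_nat.
  by exists m0 => y y1c; apply: (Hm0 m0 (leqnn m0)).
exists (m'.+1%:R^-1 * scale_power (- m'%:R)), ((2 * m).+1%:R * (scale_power m%:R * H) + 1).
split.
- by rewrite mulr_gt0 // ?invr_gt0 // scale_power_gt0.
- by rewrite ltr_wpDl // mulr_ge0 // mulr_ge0 // ltW // scale_power_gt0.
move=> v k vk; apply/andP; split; last first.
  rewrite wE -lee_fin fineK ?(esum_fin _ _ vk) // (le_trans (esum_le _ _ vk)) //.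
  by rewrite lee_fin ler_wpM2r ?lerDl // ltW // scale_power_gt0.
have [n [nm hn]] : exists n : int, (`|n| <= m')%N /\ m'.+1%:R^-1 <= h (B ^ n *m (B ^ k *m v)).
  by apply: Hm'; move: vk => /andP[/ltW -> ->].
apply: le_trans (T_le _ _ (n + k) vk); rewrite TE.
rewrite exprzDr // -mulmxE -mulmxA -mulrA mulrC ler_pM //.
- by rewrite mulr_ge0 // ltW // scale_power_gt0.
- rewrite -scale_powerD; apply: scale_power_le.
  rewrite intrD; have : n%:~R <= m'%:R :> R.
    by rewrite -[m'%:R]/(m'%:Z%:~R : R) ler_int; clear -nm; lia.
  by lra.
Qed.

End PseudoNormScale.

(** * Comparison of the visual metric with the pseudo-norm *)

(** Take the last exponent, going down from a large one, at which the vector is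
still longer than 1; at the next exponent it is at most 1, and one dilation by [B]
multiplies the norm by at most [d.+1%:R * `|B|]. *)
Lemma exists_scale (R : realType) d (B : 'M[R]_d.+1) C rho (v : 'cV[R]_d.+1) :
  expands_with B C rho -> v != 0 ->
  exists k : int, 1 < `|B ^ k *m v| <= d.+1%:R * `|B|.
Proof.
move=> eB v0; have [uB C0 rho01 Bx] := eB; have [rho0 rho1] := andP rho01.
have nv : 0 < `|v| by rewrite normr_gt0.
have [n Hn] := geometric_small C rho01 nv.
have n1 : 1 < `|B ^+ n *m v|.
  have Cr : 0 < C * rho ^+ n by rewrite mulr_gt0 // exprn_gt0.
  have := lt_le_trans (Hn n (leqnn n)) (Bx n v).
  by rewrite -[X in X < _]mulr1 ltr_pM2l.
have ex : exists i : nat, `|B ^ (n%:Z - i%:Z) *m v| <= 1.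
  have [M HM] := geometric_small (C * `|B ^+ n *m v|) rho01 ltr01.
  exists M; have := expansion_int_le eB (n%:Z - M%:Z) M v.
  rewrite subrK => /le_trans; apply; rewrite mulrAC; exact/ltW/HM.
case: (ex_minnP ex) => -[|i] hi imin.
  by move: n1; rewrite ltNge; move: hi; rewrite subr0 => ->.
exists (n%:Z - i%:Z); apply/andP; split.
  by rewrite ltNge; apply/negP => /imin; rewrite ltnn.
have -> : n%:Z - i%:Z = 1 + (n%:Z - i.+1%:Z) by lia.
rewrite exprzDr // expr1z -mulmxE -mulmxA (le_trans (norm_mulmx_le _ _)) //.
by rewrite ler_piMr // mulr_ge0.
Qed.

Lemma powR_expR (R : realType) (u t : R) : expR u `^ t = expR (t * u).
Proof. by rewrite /powR gt_eqF ?expR_gt0 // expRK. Qed.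

Unset Implicit Arguments.

(* The dimension of the space is d.+1, that is, an arbitrary positive integer. *)
Theorem theorem1p3 (R : realType) (d N q : nat)
  (A : 'M[int]_d.+1) (D : 'I_N -> 'cV[int]_d.+1)
  (K J : set 'cV[R]_d.+1) (w : 'cV[R]_d.+1 -> R)
  (A_expanding : expanding R A)
  (det_A : `|\det A|%N = q)
  (K_nonempty : K !=set0)
  (K_compact : compact K)
  (K_invariant : K = \bigcup_(i in [set: 'I_N]) (ifs_map A D i @` K))
  (J_nonempty : J !=set0)
  (J_bounded : bounded_set J)
  (J_closed : closed J)
  (J_stable : forall i : 'I_N, ifs_map A D i @` J `<=` J)
  (w_pseudo_norm : pseudo_norm A q w) :
  let o := root_vertex R A D in
  let E := ifs_graph A D J in
  hyperbolic R E o /\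
  forall delta a : R,
    hyperbolic_with E o delta ->
    0 < a ->
    expR (3 * delta * a) < Num.sqrt 2 ->
    let alpha := ln (q%:R : R) / (d.+1%:R * a) in
    exists phi : set (nat -> vertex R A D) -> 'cV[R]_d.+1,
      set_bij (hyperbolic_boundary E o a) K phi /\
      exists2 C : R, 0 < C &
        forall xi eta : set (nat -> vertex R A D),
          hyperbolic_boundary E o a xi ->
          hyperbolic_boundary E o a eta ->
          xi <> eta ->
          C^-1 * w (phi xi - phi eta)
            <= visual_metric_boundary E o a xi eta `^ alpha /\
          visual_metric_boundary E o a xi eta `^ alpha
            <= C * w (phi xi - phi eta).
Proof.
move=> o E.
have [C [rho expB]] := expanding_expands_with A_expanding.
have q_gt0 : (0 < q)%N.
  have := expanding_unitmx A_expanding; rewrite unitmxE unitfE det_map_mx intr_eq0.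
  by rewrite -det_A absz_gt0.
have J_compact : compact J by exact: cV_compact.
have K_closed : closed K by apply: compact_closed => //; exact: norm_hausdorff.
have [p Kp] := K_nonempty.
have K_stable (i : 'I_N) : ifs_map A D i @` K `<=` K.
  by move=> x ix; rewrite K_invariant; exists i.
have [b [J_le K_le]] : exists b : R, (forall x, J x -> `|x| <= b) /\ (forall x, K x -> `|x| <= b).
  move: J_bounded (compact_bounded K_compact) => [M1 [_ H1]] [M2 [_ H2]].
  have n1 := ler_norm M1; have n2 := ler_norm M2.
  have p1 := normr_ge0 M1; have p2 := normr_ge0 M2.
  exists (`|M1| + `|M2| + 1); split=> x; [apply: H1|apply: H2]; lra.
pose gp_ge0 := @gromov_product_ge0 R d N A D J.
pose gp_self := @gromov_product_self R d N A D J.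
pose gp_le := @gromov_product_le R d N A D J.
pose gp_sym := @gromov_product_sym R d N A D J.
pose gp_close := gromov_product_close (J := J) expB K_stable Kp J_le K_le.
pose close_gp := close_gromov_product expB J_nonempty J_compact J_stable Kp J_le K_le.
split; first exact: (hyperbolic_of_centers gp_ge0 gp_close close_gp).
move=> delta a _ a0 _ alpha.
pose P := sequences_to (@level R d N A D) (center p).
have lim x : K x -> exists s, P x s.
  by move=> Kx; apply: (limit_of_vertices expB Kp K_le) Kx.
have center_K (x : vertex R A D) : K (center p x) by exact: (word_map_stable (repr x) K_stable Kp).
have bdE : hyperbolic_boundary E o a = P @` K.
  exact: (hyperbolic_boundaryE expB gp_self gp_le gp_sym gp_close close_gp
    a0 K_closed center_K lim).
pose phi (xi : set (nat -> vertex R A D)) : 'cV[R]_d.+1 :=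
  if pselect (exists x, K x /\ xi = P x) is left h then sval (cid h) else 0.
have phiP x : K x -> phi (P x) = x.
  move=> Kx; rewrite /phi; case: pselect => [h|]; last by case; exists x.
  have [Ky e] := svalP (cid h); have [s sx] := lim x Kx.
  by apply/esym/(sequences_to_inj sx); rewrite -/(P _) -e.
exists phi; split.
  rewrite bdE; split.
  - by move=> _ [x Kx <-]; rewrite phiP.
  - by move=> _ _ /set_mem[x Kx <-] /set_mem[y Ky <-]; rewrite !phiP // => ->.
  - by move=> x Kx; exists (P x); [exists x|exact: phiP].
have c0 : 0 <= d.+1%:R * `|real_mx R A| by rewrite mulr_ge0.
have [m Hm] := gromov_product_boundary_scale expB gp_ge0 gp_close close_gp K_le lim c0.
have [c1 [c2 [c1_0 c2_0 Hw]]] :=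
  pseudo_norm_scale expB q_gt0 w_pseudo_norm (d.+1%:R * `|real_mx R A|).
pose sp := scale_power d q : R -> R.
have sp0 t : 0 < sp t by exact: scale_power_gt0.
exists (sp m%:R / c1 + sp m%:R * c2).
  by rewrite addr_gt0 // ?divr_gt0 // mulr_gt0.
move=> xi eta; rewrite bdE => -[x Kx <-] [y Ky <-] xy; rewrite !phiP //.
have v0 : x - y != 0 by rewrite subr_eq0; apply: contra_not_neq xy => ->.
have [k vk] := exists_scale expB v0.
have /andP[wk1 wk2] := Hw _ _ vk.
have gk := Hm _ _ _ Kx Ky vk.
set g := fine _ in gk.
have -> : visual_metric_boundary E o a (P x) (P y) `^ alpha = sp (- g).
  rewrite /visual_metric_boundary (asboolF xy) mul1r powR_expR /sp /scale_power.
  rewrite /powR gt_eqF ?ltr0n //; congr expR; rewrite /alpha -/g.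
  have dn0 : d.+1%:R != 0 :> R by rewrite pnatr_eq0.
  have an0 : a != 0 by rewrite gt_eqF.
  move: (d.+1%:R : R) dn0 (ln _) => r rn0 l; by field; rewrite rn0 an0.
have sp1 : sp (- g) <= sp m%:R * sp (- k%:~R).
  by rewrite /sp -scale_powerD //; apply: scale_power_le => //; move: gk; rewrite ler_norml; lra.
have sp2 : sp (- k%:~R) <= sp m%:R * sp (- g).
  by rewrite /sp -scale_powerD //; apply: scale_power_le => //; move: gk; rewrite ler_norml; lra.
have w0 : 0 <= w (x - y) by apply: le_trans wk1; rewrite ltW // mulr_gt0.
have w_le : w (x - y) <= c2 * (sp m%:R * sp (- g)).
  by rewrite (le_trans wk2) // ler_wpM2l // ltW.
have sp_le : sp (- g) <= sp m%:R * (w (x - y) / c1).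
  by rewrite (le_trans sp1) // ler_wpM2l ?(ltW (sp0 _)) // ler_pdivlMr // mulrC.
have w_ge : 0 <= sp m%:R / c1 * sp (- g) by rewrite ltW // mulr_gt0 // divr_gt0.
have sp_ge : 0 <= sp m%:R * c2 * w (x - y) by rewrite mulr_ge0 // ltW // mulr_gt0.
split.
  rewrite ler_pdivrMl; last by rewrite addr_gt0 // ?divr_gt0 // mulr_gt0.
  by rewrite mulrDl (le_trans w_le) // mulrCA mulrA lerDr.
by rewrite mulrDl (le_trans sp_le) // mulrA mulrAC lerDl.
Qed.
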